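(* Let $E\subset\mathcal E$ be two Banach spaces with continuous embedding and $E$ dense in $\mathcal E$. Let $\mathcal L\in\mathscr C(\mathcal E)$ be such that $L:=\mathcal L_{|E}\in\mathscr C(E)$, and let $a\in\mathbb R$, $\Delta_a=\{z\in\mathbb C:\ \Re e\,z>a\}$. Assume: (H1) There are distinct $\xi_1,\dots,\xi_k\in\Delta_a$, $k\in\mathbb N$ (with $\{\xi_1,\dots,\xi_k\}=\emptyset$ if $k=0$) such that $\Sigma(L)\cap\Delta_a=\{\xi_1,\dots,\xi_k\}\subset\Sigma_d(L)$. (H2) There are operators $\mathcal A,\mathcal B$ on $\mathcal E$ with $\mathcal L=\mathcal A+\mathcal B$ and (i) $\mathcal B\in\mathscr C(\mathcal E)$ is such that $\mathcal R_{\mathcal B}(z)$ is bounded in $\mathscr B(\mathcal E)$ uniformly in $z\in\Delta_a$ and $\|\mathcal R_{\mathcal B}(z)\|_{\mathscr B(\mathcal E)}\to0$ as $\Re e\,z\to\infty$ (in particular $\Sigma(\mathcal B)\cap\Delta_a=\emptyset$); (ii) $\mathcal A\in\mathscr B(\mathcal E)$; (iii) there is $n\ge1$ such that $(\mathcal A\mathcal R_{\mathcal B}(z))^n$ is bounded in $\mathscr B(\mathcal E,E)$ uniformly in $z\in\Delta_a$. Then in $\mathcal E$: (i) $\Sigma(\mathcal L)\cap\Delta_a=\{\xi_1,\dots,\xi_k\}$. (ii) For every $z\in\Delta_a\setminus\{\xi_1,\dots,\xi_k\}$, $$\mathcal R_{\mathcal L}(z)=\sum_{\ell=0}^{n-1}(-1)^\ell\mathcal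 R_{\mathcal B}(z)\big(\mathcal A\mathcal R_{\mathcal B}(z)\big)^\ell+(-1)^n\mathcal R_L(z)\big(\mathcal A\mathcal R_{\mathcal B}(z)\big)^n.$$ (iii) For every $i=1,\dots,k$: $N(L-\xi_i)^m=N(\mathcal L-\xi_i)^m$ for all $m\ge1$, $M(L-\xi_i)=M(\mathcal L-\xi_i)$, and $$(\Pi_{\mathcal L,\xi_i})_{|E}=\Pi_{L,\xi_i},\qquad S_{\mathcal L,\xi_i}(t)=S_{L,\xi_i}(t)\,\Pi_{\mathcal L,\xi_i}=S_L(t)\,\Pi_{\mathcal L,\xi_i}.$$
   Context: $\mathscr B(X,Y)$: bounded linear operators from $X$ to $Y$; $\mathscr B(X)=\mathscr B(X,X)$. $\mathscr C(X)$: closed unbounded linear operators on $X$ with dense domain. $L=\mathcal L_{|E}$ is the restriction of $\mathcal L$ to $E$ ($Lf=\mathcal Lf$ for $f\in\mathrm{Dom}(L)\subset E\cap \mathrm{Dom}(\mathcal L)$). For $\Lambda\in\mathscr C(X)$: $\Sigma(\Lambda)$ is its spectrum, $N(\cdot)$ denotes null space, $\mathrm R(\cdot)$ range, $\mathcal R_\Lambda(z):=(\Lambda-z)^{-1}$ for $z\notin\Sigma(\Lambda)$, $N(\Lambda-\xi)^m$ is the null space of $(\Lambda-\xi)^m$, $M(\Lambda-\xi):=\bigcup_{\alpha\ge1}N(\Lambda-\xi)^\alpha$. An eigenvalue $\xi$ is isolated if $\Sigma(\Lambda)\cap\{|z-\xi|\le r\}=\{\xi\}$ for some $r>0$; then for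 $0<r'<r$ $$\Pi_{\Lambda,\xi}:=-\frac1{2i\pi}\int_{|z-\xi|=r'}\mathcal R_\Lambda(z)\,dz,\qquad S_{\Lambda,\xi}(t):=-\frac1{2i\pi}\int_{|z-\xi|=r'}e^{zt}\mathcal R_\Lambda(z)\,dz,\ t\ge0.$$ $\Sigma_d(\Lambda)$ is the set of discrete eigenvalues: isolated eigenvalues $\xi$ with $\mathrm R(\Pi_{\Lambda,\xi})$ finite dimensional. $S_L(t)$ is the semigroup generated by $L$ (here it only acts on the finite-dimensional $L$-invariant space $\mathrm R(\Pi_{L,\xi_i})$, where it is the exponential of the restriction of $L$). *)

(* Defs.v *)
From HB Require Import structures.
From mathcomp Require Import all_boot all_order all_algebra.
From mathcomp Require Import all_classical all_reals all_analysis.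
From mathcomp Require Import complex.

Set Implicit Arguments.
Unset Strict Implicit.
Unset Printing Implicit Defensive.

Import Order.TTheory GRing.Theory Num.Theory.
Import numFieldNormedType.Exports.

Local Open Scope classical_set_scope.
Local Open Scope ring_scope.
Local Open Scope complex_scope.

Section BoundedOperators.
Context {R : realType}.
Implicit Types X Y : normedModType R[i].

(* The norm of a normedModType R[i] takes its values in R[i]; it is
   nonnegative, hence real, and Re reads it in R. *)
Definition opnorm X Y (T : X -> Y) : \bar R :=
  ereal_sup [set (complex.Re `|T x|)%:E | x in [set x : X | `|x| <= 1]].

Definition bounded_op X Y (T : X -> Y) : Prop :=
  linear T /\ (opnorm T < +oo)%E.

(* For T with values in the image of the injection iota, T seen as a map
   into E. *)
Definition corestr (E X : normedModType R[i]) (iota : E -> X) (T : X -> X)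
    : X -> E :=
  fun f => xget 0 [set g | iota g = T f].

End BoundedOperators.

Section UnboundedOperators.
Context {R : realType}.

(* op is only meaningful on dom. *)
Record unbounded_op (X : normedModType R[i]) := UnboundedOp {
  dom : set X;
  op :> X -> X;
  dom0 : dom 0;
  dom_linear : forall (c : R[i]) x y, dom x -> dom y -> dom (c *: x + y);
  op_linear : forall (c : R[i]) x y, dom x -> dom y ->
    op (c *: x + y) = c *: op x + op y
}.

Variable X : normedModType R[i].
Implicit Type T : unbounded_op X.

(* T is not required to be unbounded: an everywhere defined bounded operator
   also qualifies. *)
Definition closed_densely_defined T : Prop :=
  closed [set p : X * X | dom T p.1 /\ p.2 = T p.1] /\ dense (dom T).

Definition op_shift T (z : R[i]) : X -> X := fun x => T x - z *: x.

Definition resolvent T (z : R[i]) : X -> X :=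
  fun x => xget 0 [set y | dom T y /\ op_shift T z y = x].

Definition spectrum T : set R[i] :=
  [set z | ~ (set_bij (dom T) setT (op_shift T z) /\
              bounded_op (resolvent T z))].

Definition eigenvalues T : set R[i] :=
  [set z | exists2 x, dom T x & x != 0 /\ T x = z *: x].

(* Null space of (T - z)^m; a vector belongs to Dom((T - z)^m) when all the
   iterates of order < m stay in Dom(T). *)
Definition null_pow T (z : R[i]) (m : nat) : set X :=
  [set x | (forall j, (j < m)%N -> dom T (iter j (op_shift T z) x)) /\
           iter m (op_shift T z) x = 0].

Definition gen_eigenspace T (z : R[i]) : set X :=
  \bigcup_(m in [set m | (1 <= m)%N]) null_pow T z m.

End UnboundedOperators.

Section ContourIntegrals.
Context {R : realType}.
Variables X Y : normedModType R[i].

(* s lists the points x_1 < ... < x_N = b of a subdivision of [a, b], with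
   x_0 = a, and tag i is the tag chosen in [x_i, x_(i+1)]. *)
Definition riemann_sum (F : R -> X -> Y) (a : R) (s : seq R) (tag : nat -> R)
    : X -> Y :=
  \sum_(i < size s) (nth a (a :: s) i.+1 - nth a (a :: s) i)%:C *: F (tag i).

Definition tagged_partition (a b delta : R) (s : seq R) (tag : nat -> R) :=
  itv_partition a b s /\
  forall i, (i < size s)%N ->
    [/\ nth a (a :: s) i <= tag i, tag i <= nth a (a :: s) i.+1
      & nth a (a :: s) i.+1 - nth a (a :: s) i < delta].

(* P is the Riemann integral of F over [a, b] in the space of bounded
   operators: the Riemann sums converge to P in operator norm as the mesh of
   the subdivision tends to 0. *)
Definition is_op_integral (F : R -> X -> Y) (a b : R) (P : X -> Y) : Prop :=
  bounded_op P /\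
  forall eps : R, 0 < eps -> exists2 delta : R, 0 < delta &
    forall s tag, tagged_partition a b delta s tag ->
      (opnorm (riemann_sum F a s tag - P)%R < eps%:E)%E.

Definition op_integral (F : R -> X -> Y) (a b : R) : X -> Y :=
  xget 0 (is_op_integral F a b).

Definition expC (z : R[i]) : R[i] :=
  (expR (complex.Re z))%:C * (cos (complex.Im z) +i* sin (complex.Im z)).

Definition circle_point (r theta : R) : R[i] := r%:C * expC (0 +i* theta).

(* Integral of F(z) dz over |z - xi| = r, counterclockwise. *)
Definition circle_integral (F : R[i] -> X -> Y) (xi : R[i]) (r : R) : X -> Y :=
  op_integral
    (fun theta => ('i%C * circle_point r theta) *: F (xi + circle_point r theta))
    0 (2 * pi).

End ContourIntegrals.

Section DiscreteSpectrum.
Context {R : realType}.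
Variable X : normedModType R[i].
Implicit Type T : unbounded_op X.

Definition isolated_at T (xi : R[i]) (r : R) : Prop :=
  0 < r /\ spectrum T `&` [set z | `|z - xi| <= r%:C] = [set xi].

(* The radii r' of the circles used to define the spectral projector. *)
Definition contour_radius T (xi : R[i]) (r' : R) : Prop :=
  0 < r' /\ exists2 r, r' < r & isolated_at T xi r.

(* The operators Pi and S(t) are kept dependent on the radius of the contour;
   statements quantify over all admissible radii. *)
Definition spectral_proj T (xi : R[i]) (r' : R) : X -> X :=
  (- (2 * 'i%C * pi%:C)^-1) *: circle_integral (resolvent T) xi r'.

Definition spectral_semigroup T (xi : R[i]) (r' t : R) : X -> X :=
  (- (2 * 'i%C * pi%:C)^-1) *:
    circle_integral (fun z => expC (z * t%:C) *: resolvent T z) xi r'.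

Definition finite_dimensional (V : set X) : Prop :=
  exists (d : nat) (e : 'I_d -> X),
    V `<=` [set x | exists c : 'I_d -> R[i], x = \sum_i c i *: e i].

Definition discrete_spectrum T : set R[i] :=
  [set xi | eigenvalues T xi /\
     exists2 r', contour_radius T xi r' &
       finite_dimensional (range (spectral_proj T xi r'))].

(* exp(t T) f = sum_j t^j / j! T^j f; only meaningful for f in a
   finite-dimensional T-invariant subspace of Dom(T). *)
Definition exp_op T (t : R) (f : X) : X :=
  limn (series (fun j => (t ^+ j / j`!%:R)%:C *: iter j T f)).

End DiscreteSpectrum.

Definition half_plane {R : realType} (a : R) : set R[i] :=
  [set z | a < complex.Re z].

(* Dom(L) need only be contained in the domain of LL intersected with E; it is
   not assumed to consist of all the f in E and Dom(LL) with LLf in E. *)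
Definition is_restriction {R : realType} (E X : normedModType R[i])
    (iota : E -> X) (LL : unbounded_op X) (L : unbounded_op E) : Prop :=
  forall f, dom L f -> dom LL (iota f) /\ LL (iota f) = iota (L f).

(* Main.v *)
(** The partial sum V = sum_(l < n) (-1)^l R_B (A R_B)^l satisfies
    (LL - z) V = 1 - (-1)^n (A R_B)^n, and (A R_B)^n takes its values in E, where
    R_L inverts the remainder; so the right-hand side U(z) of (ii) is a right
    inverse of LL - z wherever L - z is invertible.  For Re z large, LL - z is
    invertible by a Neumann series.  Since ||U(z)|| is locally bounded off the
    spectrum of L, invertibility of LL - z propagates along a segment avoiding
    the xi_i, which gives (i) and (ii).

    Contour integrals are handled without Cauchy's theorem, through the sums
    S_N(r) = -(1/N) sum_j w_j R(xi + w_j) over w_j = r e^(2 pi i j / N).  The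
    resolvent identity and sum_j w_j / (w_j - v) = N r^N / (r^N - v^N) give
    exactly (r'^N - r^N) S_N(r) S_N(r') = r'^N S_N(r) - r^N S_N(r'), so that
    Pi_r Pi_r' = Pi_r' Pi_r = Pi_r for r < r'.  As Pi_r depends continuously on
    r, nearby projectors coincide, hence Pi_r does not depend on r and is
    idempotent.  The exact sums also give Pi f = f on N(T - xi)^m, and closedness of T
    gives T^j Pi = -(1/2 pi i) \oint z^j R(z) dz, whence S(t) = exp(t T) Pi.

    Finally R_LL = R_L on E gives Pi_LL = Pi_L on E; the range of Pi_L being finite
    dimensional, it is closed in the large space, and by density of E it is the
    whole range of Pi_LL. *)
Require Import Defs.
From HB Require Import structures.
From mathcomp Require Import all_boot all_order all_algebra.
From mathcomp Require Import all_classical all_reals all_analysis.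
From mathcomp Require Import complex.
From mathcomp Require Import ring lra zify.
Set Implicit Arguments.
Unset Strict Implicit.
Unset Printing Implicit Defensive.
Import Order.TTheory GRing.Theory Num.Theory.
Import numFieldNormedType.Exports.
Local Open Scope classical_set_scope.
Local Open Scope ring_scope.
Local Open Scope complex_scope.

(** * Real-valued norms and convergence *)

Section RealNorm.
Context {R : realType}.
Local Notation C := R[i].

(** Limits are taken pointwise: for fixed x, a contour integral is the limit of the sums over the
    w_j, so identities that are exact for finite N pass to the limit. The operator-norm convergence
    in [is_op_integral] enters only through existence and uniqueness of the integral. The product
    identity divides by r'^N - r^N, hence says nothing at r = r'. Idempotence must come from r' ->
    r, which is why continuity in r is made quantitative. Two nested projectors differ by a
    projector, and a projector of norm below 1 vanishes: this is why nearby ones coincide. The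
    change of radius and the propagation of invertibility are both inductions along a real interval
    ([path_ind]), fed by one estimate, [resolvent_open]: if ||R(w)|| <= c and |z - w| c <= 1/2, then
    ||R(z)|| <= 2 c. The + 1 in radii such as (2 (c + 1))^-1 keeps the denominator positive when c =
    0. Dom(L) may be smaller than the set of f in E with LL f in E, so membership in Dom(L) is
    obtained by writing the vector as a value of R_L(z). *)

Definition nm (X : normedZmodType C) (x : X) : R := complex.Re `|x|.

Section Generic.
Variable X : normedZmodType C.
Implicit Types x y : X.

(** A nonnegative complex number has zero imaginary part. Facts about the complex-valued norm are
    carried over to the real-valued [nm] through this equality, where the order is total and [lra]
    and [nra] apply. *)
Lemma nmE x : `|x| = (nm x)%:C.
Proof. by have := ger0_Im (normr_ge0 x); rewrite /nm; case: `|x| => u v /= ->. Qed.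

Lemma nm_ge0 x : 0 <= nm x.
Proof. by have := normr_ge0 x; rewrite nmE lecR. Qed.

Lemma nm0 : nm (0 : X) = 0.
Proof. by rewrite /nm normr0. Qed.

Lemma nm_eq0 x : nm x = 0 -> x = 0.
Proof. by move=> h; apply/normr0_eq0; rewrite nmE h. Qed.

Lemma nm_le0 x : nm x <= 0 -> x = 0.
Proof. by move=> h; apply: nm_eq0; apply/eqP; rewrite eq_le h nm_ge0. Qed.

Lemma nmD x y : nm (x + y) <= nm x + nm y.
Proof. by have := ler_normD x y; rewrite !nmE -rmorphD lecR. Qed.

Lemma nmN x : nm (- x) = nm x.
Proof. by rewrite /nm normrN. Qed.

Lemma nmBC x y : nm (x - y) = nm (y - x).
Proof. by rewrite -opprB nmN. Qed.

Lemma nmB x y : nm (x - y) <= nm x + nm y.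
Proof. by rewrite -(nmN y) nmD. Qed.

Lemma nm_triangle z x y : nm (x - y) <= nm (x - z) + nm (z - y).
Proof. by rewrite -{1}(subrK z x) -addrA nmD. Qed.

Lemma nm_sum (I : Type) (s : seq I) (P : pred I) (F : I -> X) :
  nm (\sum_(i <- s | P i) F i) <= \sum_(i <- s | P i) nm (F i).
Proof.
elim/big_ind2: _ => [|u a v b hu hv|//]; first by rewrite nm0.
exact: le_trans (nmD _ _) (lerD hu hv).
Qed.

End Generic.

Lemma nmM (c d : C) : nm (c * d) = nm c * nm d.
Proof. by have := normrM c d; rewrite !nmE -rmorphM => /complexI. Qed.

Lemma nm1 : nm (1 : C) = 1.
Proof. by rewrite /nm normr1. Qed.

Lemma nmX (c : C) n : nm (c ^+ n) = nm c ^+ n.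
Proof. by elim: n => [|n IH]; rewrite ?expr0 ?nm1 // !exprS nmM IH. Qed.

Lemma nmV (c : C) : nm (c^-1) = (nm c)^-1.
Proof. by have := normfV c; rewrite !nmE -fmorphV => /complexI. Qed.

Lemma nmZ (X : normedModType C) (c : C) (x : X) : nm (c *: x) = nm c * nm x.
Proof. by have := normrZ c x; rewrite !nmE -rmorphM => /complexI. Qed.

Lemma nmR (a : R) : nm a%:C = `|a|.
Proof.
by rewrite /nm normc_def /= expr0n addr0 sqrtr_sqr.
Qed.

Lemma nm_Re (c : C) : `|complex.Re c| <= nm c.
Proof. by have := normc_ge_Re c; rewrite nmE lecR. Qed.

Lemma nmi : nm ('i%C : C) = 1.
Proof. by rewrite /nm normc_def /= expr0n add0r expr1n sqrtr1. Qed.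

Lemma nm_Im (c : C) : `|complex.Im c| <= nm c.
Proof.
have -> : complex.Im c = - complex.Re ('i%C * c).
  by case: c => u v /=; rewrite mul0r mul1r sub0r opprK.
by rewrite normrN (le_trans (nm_Re _)) // nmM nmi mul1r.
Qed.

Lemma nm_ReIm (c : C) : nm c <= `|complex.Re c| + `|complex.Im c|.
Proof.
have {1}-> : c = (complex.Re c)%:C + 'i%C * (complex.Im c)%:C.
  by case: c => u v; apply/eqP; rewrite eq_complex /=; apply/andP; split; apply/eqP; ring.
apply: le_trans (nmD _ _) _; by rewrite nmM nmi mul1r !nmR.
Qed.

End RealNorm.

Section Convergence.
Context {R : realType}.
Local Notation C := R[i].

(** Convergence stated as a real null sequence, so that it can be proved by squeezing real bounds;
    [tends_cvg] links it to convergence of filters. *)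
Definition tends (X : normedZmodType C) (u : nat -> X) (l : X) : Prop :=
  (fun n => nm (u n - l)) @ \oo --> (0 : R).

Section Generic.
Variable X : normedZmodType C.
Implicit Types (u v : nat -> X) (l m : X).

Lemma tends_le u l (b : nat -> R) :
  (\forall n \near \oo, nm (u n - l) <= b n) -> b @ \oo --> (0 : R) -> tends u l.
Proof.
move=> ub b0; apply: (@squeeze_cvgr _ _ _ _ (fun=> 0) b) => //; last exact: cvg_cst.
by near=> n; rewrite nm_ge0 /=; near: n.
Unshelve. all: by end_near. Qed.

Lemma tends_cst l : tends (fun=> l) l.
Proof. by rewrite /tends; under eq_fun do rewrite subrr nm0; exact: cvg_cst. Qed.

Lemma tendsD u v l m : tends u l -> tends v m -> tends (fun n => u n + v n) (l + m).
Proof.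
move=> ul vm; apply: (@tends_le _ _ (fun n => nm (u n - l) + nm (v n - m))).
  by near=> n; rewrite opprD addrACA nmD.
by rewrite -[X in _ --> X](addr0 (0 : R)); apply: cvgD.
Unshelve. all: by end_near. Qed.

Lemma tends_unique u l m : tends u l -> tends u m -> l = m.
Proof.
move=> ul um; apply/eqP; rewrite -subr_eq0; apply/eqP/nm_le0.
have h : (fun n => nm (u n - l) + nm (u n - m)) @ \oo --> (0 + 0 : R) by apply: cvgD.
rewrite addr0 in h.
apply: (@ler_cvg_to _ _ _ _ (fun=> nm (l - m)) _ _ _ _ h); first exact: cvg_cst.
by near=> n; rewrite (le_trans (nm_triangle (u n) _ _)) // nmBC.
Unshelve. all: by end_near. Qed.

Lemma tends_near u v l : (\forall n \near \oo, u n = v n) -> tends u l -> tends v l.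
Proof.
move=> uv ul; apply: (tends_le _ ul).
by near=> n; have <- : u n = v n by near: n.
Unshelve. all: by end_near. Qed.

Lemma tends_nm_le u l (b : nat -> R) (c : R) : tends u l -> b @ \oo --> c ->
  (\forall n \near \oo, nm (u n) <= b n) -> nm l <= c.
Proof.
move=> ul bc ub.
have h : (fun n => nm (u n - l) + b n) @ \oo --> (0 + c : R) by apply: cvgD.
rewrite add0r in h.
apply: (@ler_cvg_to _ _ _ _ (fun=> nm l) _ _ _ _ h); first exact: cvg_cst.
near=> n; have : nm (u n) <= b n by near: n.
have : nm l <= nm (u n - l) + nm (u n).
  by rewrite [X in _ <= X]addrC -{1}(subKr (u n) l) nmB.
by move=> h1 h2; apply: le_trans h1 _; rewrite lerD2l.
Unshelve. all: by end_near. Qed.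

End Generic.

Lemma tends_linear (X Y : normedModType C) (f : X -> Y) (c : R) (u : nat -> X) l :
  (forall x y, f (x - y) = f x - f y) -> (forall x, nm (f x) <= c * nm x) ->
  tends u l -> tends (fun n => f (u n)) (f l).
Proof.
move=> fB fb ul; apply: (@tends_le _ _ _ (fun n => c * nm (u n - l))).
  by near=> n; rewrite -fB fb.
by rewrite -(mulr0 c); apply: cvgM ul; exact: cvg_cst.
Unshelve. all: by end_near. Qed.

Lemma tendsZ (X : normedModType C) (c : nat -> C) (k : C) (u : nat -> X) l :
  tends c k -> tends u l -> tends (fun n => c n *: u n) (k *: l).
Proof.
move=> ck ul; apply: (@tends_le _ _ _
   (fun n => nm (c n - k) * nm (u n - l) + nm k * nm (u n - l) + nm (c n - k) * nm l)).
  near=> n.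
  have -> : c n *: u n - k *: l = (c n - k) *: (u n - l) + k *: (u n - l) + (c n - k) *: l.
    by rewrite -scalerDl subrK scalerBr scalerBl addrA subrK.
  by rewrite -!nmZ (le_trans (nmD _ _)) // lerD2r nmD.
have -> : 0 = 0 * 0 + nm k * 0 + 0 * nm l :> R by rewrite !mul0r mulr0 !addr0.
apply: cvgD; first apply: cvgD.
- exact: cvgM.
- by apply: cvgM ul; exact: cvg_cst.
- by apply: cvgM ck _; exact: cvg_cst.
Unshelve. all: by end_near. Qed.

Lemma tends_cvg (X : normedModType C) (u : nat -> X) l : tends u l <-> u @ \oo --> l.
Proof.
split=> [ul|/cvgrPdist_lt ul].
  apply/cvgrPdist_lt => e e0.
  have eE : e = (complex.Re e)%:C by rewrite RRe_real ?gtr0_real.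
  have e0' : 0 < complex.Re e by rewrite -ltcR -eE.
  move/cvgrPdist_lt : ul => /(_ _ e0') ul.
  near=> n; rewrite nmE eE ltcR nmBC.
  have : `|0 - nm (u n - l)| < complex.Re e by near: n.
  by rewrite sub0r normrN ger0_norm ?nm_ge0.
apply/cvgrPdist_lt => e e0; have e0' : 0 < e%:C by rewrite ltcR.
near=> n; rewrite sub0r normrN ger0_norm ?nm_ge0 // nmBC -ltcR -nmE.
by near: n; exact: ul.
Unshelve. all: by end_near. Qed.

Lemma tends_cauchy (X : completeNormedModType C) (u : nat -> X) (b : nat -> R) :
  (forall n m, (n <= m)%N -> nm (u n - u m) <= b n) -> b @ \oo --> (0 : R) ->
  exists2 l, tends u l & forall n, nm (u n - l) <= b n.
Proof.
move=> ub b0.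
have /cvg_ex[l /= /tends_cvg ul] : cvg (u @ \oo).
  apply/cauchy_cvgP/cauchy_exP => e e0.
  have eE : e = (complex.Re e)%:C by rewrite RRe_real ?gtr0_real.
  have e0' : 0 < complex.Re e by rewrite -ltcR -eE.
  move/cvgrPdist_lt : b0 => /(_ _ e0') [N _ hN].
  exists (u N); exists N => // n /= Nn; rewrite -ball_normE /= nmE eE ltcR.
  apply: le_lt_trans (ub _ _ Nn) _; apply: le_lt_trans (ler_norm _) _.
  by have := hN N; rewrite /= sub0r normrN; apply.
exists l => // n.
have : tends (fun m => u n - u m) (u n - l).
  apply: tends_le ul; near=> m; by rewrite opprB addrC addrA subrK nmBC.
move/tends_nm_le; apply; first exact: cvg_cst.
by exists n => // m /= nm'; exact: ub.
Unshelve. all: by end_near. Qed.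

End Convergence.

(** * Bounded operators and resolvents *)

Lemma tendsN (R : realType) (X : normedZmodType R[i]) (u : nat -> X) l :
  tends u l -> tends (fun n => - u n) (- l).
Proof.
by move=> ul; apply: (tends_le _ ul); near=> n; rewrite -opprD nmN.
Unshelve. all: by end_near. Qed.

Section Linear.
Context {R : realType} {X Y : normedModType R[i]}.
Variable f : X -> Y.
Hypothesis fL : linear f.

Lemma linD x y : f (x + y) = f x + f y.
Proof. by have := fL 1 x y; rewrite !scale1r. Qed.

Lemma lin0 : f 0 = 0.
Proof. by apply: (@addIr _ (f 0)); rewrite add0r -linD addr0. Qed.

Lemma linZ c x : f (c *: x) = c *: f x.
Proof. by have := fL c x 0; rewrite lin0 !addr0. Qed.

Lemma linB x y : f (x - y) = f x - f y.
Proof. by rewrite -scaleN1r addrC fL scaleN1r addrC. Qed.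

Lemma lin_sum (I : Type) (s : seq I) (F : I -> X) :
  f (\sum_(i <- s) F i) = \sum_(i <- s) f (F i).
Proof.
elim: s => [|i s IH]; first by rewrite !big_nil lin0.
by rewrite !big_cons linD IH.
Qed.

End Linear.

Section Bounds.
Context {R : realType}.
Local Notation C := R[i].

(** An explicit real constant replaces [opnorm], whose values are extended reals, so that estimates
    can be combined by ordinary arithmetic. *)
Definition op_bound (X Y : normedModType C) (f : X -> Y) (c : R) : Prop :=
  forall x, nm (f x) <= c * nm x.

Section Generic.
Variables X Y : normedModType C.
Implicit Type f : X -> Y.

Lemma op_bound_le f c d : c <= d -> op_bound f c -> op_bound f d.
Proof. by move=> cd fc x; apply: le_trans (fc x) _; rewrite ler_wpM2r ?nm_ge0. Qed.

Lemma op_bound_opnorm f c : 0 <= c -> op_bound f c -> (opnorm f <= c%:E)%E.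
Proof.
move=> c0 fc; apply: ge_ereal_sup => _ [x /= x1 <-]; rewrite lee_fin.
apply: le_trans (fc x) _; rewrite -[leRHS]mulr1 ler_wpM2l //.
by rewrite -lecR -nmE.
Qed.

Lemma opnorm_op_bound f c : linear f -> (opnorm f <= c%:E)%E -> op_bound f c.
Proof.
move=> fL fc x; have [->|x0] := eqVneq x 0; first by rewrite lin0 // !nm0 mulr0.
have nx : 0 < nm x by rewrite lt_neqAle nm_ge0 andbT eq_sym; apply: contra_neq x0 => /nm_eq0.
have : ((nm (f ((nm x)^-1%:C *: x)))%:E <= c%:E)%E.
  apply: le_trans fc; apply: ereal_sup_ubound; exists ((nm x)^-1%:C *: x) => //=.
  by rewrite nmE nmZ nmR ger0_norm ?invr_ge0 ?nm_ge0 // mulVf ?gt_eqF.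
rewrite lee_fin linZ // nmZ nmR ger0_norm ?invr_ge0 ?nm_ge0 //.
by rewrite mulrC ler_pdivrMr.
Qed.

Lemma bounded_opP f :
  bounded_op f <-> linear f /\ exists2 c, 0 <= c & op_bound f c.
Proof.
split=> [[fL fb]|[fL [c c0 fc]]]; split=> //; last first.
  by apply: le_lt_trans (op_bound_opnorm c0 fc) _; rewrite ltry.
have f0 : (0%:E <= opnorm f)%E.
  by apply: ereal_sup_ubound; exists 0; rewrite /= ?normr0 ?ler01 // lin0 // normr0.
have ffin : opnorm f \is a fin_num by rewrite ge0_fin_numE.
exists (fine (opnorm f)); first by rewrite fine_ge0.
by apply: opnorm_op_bound => //; rewrite fineK.
Qed.

End Generic.

Lemma neumann (X : completeNormedModType C) (K : X -> X) (q : R) :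
  linear K -> op_bound K q -> 0 <= q -> q < 1 -> forall x, exists u, u = x + K u.
Proof.
move=> KL Kq q0 q1 x; pose u := fix u n := if n is m.+1 then x + K (u m) else 0.
have q1' : 0 < 1 - q by rewrite subr_gt0.
have ub n : nm (u n) <= nm x / (1 - q).
  elim: n => [|n IH] /=; first by rewrite nm0 divr_ge0 ?nm_ge0 // ltW.
  apply: le_trans (nmD _ _) _; apply: le_trans (lerD (lexx _) (Kq _)) _.
  apply: le_trans (lerD (lexx _) (ler_wpM2l q0 IH)) _.
  by rewrite le_eqVlt; apply/orP; left; apply/eqP; field; rewrite gt_eqF.
(* At n = 0 this is the uniform bound [ub]; each further step applies K to the difference and gains
   a factor q. *)
have ud n k : nm (u n - u (n + k)%N) <= q ^+ n * (nm x / (1 - q)).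
  elim: n => [|n IH]; first by rewrite expr0 mul1r add0n sub0r nmN.
  rewrite addSn /= opprD addrACA subrr add0r -linB // exprS -mulrA.
  by apply: le_trans (Kq _) _; rewrite ler_wpM2l.
have b0 : (fun n => q ^+ n * (nm x / (1 - q))) @ \oo --> (0 : R).
  rewrite -(mul0r (nm x / (1 - q))); apply: cvgM; last exact: cvg_cst.
  by apply: cvg_expr; rewrite ger0_norm.
have ud' n m : (n <= m)%N -> nm (u n - u m) <= q ^+ n * (nm x / (1 - q)).
  by move=> /subnKC <-.
have [l ul _] := tends_cauchy ud' b0.
exists l; apply: (@tends_unique _ _ (fun n => u n.+1)).
  by move: ul; rewrite /tends -cvg_shiftS.
by apply: tendsD; [exact: tends_cst|apply: tends_linear Kq ul => a b; exact: linB].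
Qed.

End Bounds.

Section Resolvent.
Context {R : realType}.
Local Notation C := R[i].

Section Generic.
Variable X : normedModType C.
Variable T : unbounded_op X.
Implicit Types (z w : C) (x y : X).

Lemma domB x y : dom T x -> dom T y -> dom T (x - y).
Proof. by move=> hx hy; rewrite -scaleN1r addrC; exact: dom_linear. Qed.

Lemma op_linB x y : dom T x -> dom T y -> T (x - y) = T x - T y.
Proof. by move=> hx hy; rewrite -scaleN1r addrC op_linear // scaleN1r addrC. Qed.

Lemma domZ c x : dom T x -> dom T (c *: x).
Proof. by move=> hx; rewrite -[_ *: _]addr0; apply: dom_linear => //; exact: dom0. Qed.

Lemma op_lin0 : T 0 = 0.
Proof. by have := op_linB (dom0 T) (dom0 T); rewrite !subrr. Qed.

Lemma op_linZ c x : dom T x -> T (c *: x) = c *: T x.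
Proof.
by move=> hx; have := op_linear c hx (dom0 T); rewrite op_lin0 !addr0.
Qed.

Lemma dom_sum (I : Type) (s : seq I) (F : I -> X) :
  (forall i, dom T (F i)) -> dom T (\sum_(i <- s) F i).
Proof.
move=> hF; elim: s => [|i s IH]; first by rewrite big_nil; exact: dom0.
by rewrite big_cons -[F i]scale1r; exact: dom_linear.
Qed.

Lemma op_lin_sum (I : Type) (s : seq I) (F : I -> X) :
  (forall i, dom T (F i)) -> T (\sum_(i <- s) F i) = \sum_(i <- s) T (F i).
Proof.
move=> hF; elim: s => [|i s IH]; first by rewrite !big_nil op_lin0.
have := op_linear 1 (hF i) (dom_sum s hF).
by rewrite !big_cons !scale1r => ->; rewrite IH.
Qed.

Section Regular.
Variable z : C.
Hypothesis zT : ~ spectrum T z.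

Lemma resolvent_bij : set_bij (dom T) setT (op_shift T z) /\
  bounded_op (resolvent T z).
Proof. exact: contrapT. Qed.

Lemma resolventK x : dom T (resolvent T z x) /\
  T (resolvent T z x) - z *: resolvent T z x = x.
Proof.
have [[_ _ h] _] := resolvent_bij; have [//|y hy yx] := h x.
exact: (@xgetPex _ 0 [set y | dom T y /\ op_shift T z y = x] (ex_intro _ y (conj hy yx))).
Qed.

Lemma resolvent_dom x : dom T (resolvent T z x).
Proof. by have [] := resolventK x. Qed.

Lemma op_resolvent x : T (resolvent T z x) = x + z *: resolvent T z x.
Proof. by have [_ /eqP] := resolventK x; rewrite subr_eq => /eqP. Qed.

Lemma op_shift_inj x y : dom T x -> dom T y ->
  T x - z *: x = T y - z *: y -> x = y.
Proof.
by have [[_ h _] _] := resolvent_bij => hx hy; apply: h; rewrite inE.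
Qed.

Lemma resolvent_eq x y : dom T y -> T y - z *: y = x -> resolvent T z x = y.
Proof.
move=> hy yx; apply: op_shift_inj => //; first exact: resolvent_dom.
by have [_ ->] := resolventK x.
Qed.

Lemma resolvent_linear : linear (resolvent T z).
Proof. by have [_ []] := resolvent_bij. Qed.

Lemma resolvent_bounded : exists2 c, 0 <= c & op_bound (resolvent T z) c.
Proof. by have [_ /bounded_opP[]] := resolvent_bij. Qed.

End Regular.

Lemma resolvent_identity z w x : ~ spectrum T z -> ~ spectrum T w ->
  resolvent T z x - resolvent T w x = (z - w) *: resolvent T z (resolvent T w x).
Proof.
move=> hz hw; apply/eqP; rewrite subr_eq addrC; apply/eqP.
set y := resolvent T w x; apply: resolvent_eq => //.
  by rewrite addrC; apply: dom_linear; exact: resolvent_dom.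
rewrite addrC op_linear; [|exact: resolvent_dom..].
rewrite !op_resolvent // !scalerDr !scalerA (mulrC z) scalerBl -/y.
set p := (_ * _) *: _; set q := z *: y; set r := w *: y.
by rewrite (addrAC q) (addrC x) addrA subrK (addrC p) [LHS]addrAC subrr add0r.
Qed.

(** The lower bound does double duty: it gives injectivity of T - z, and read at y = R(z) x it
    bounds the resolvent. *)
Lemma spectrumN z c : 0 <= c ->
  (forall x, exists2 y, dom T y & T y - z *: y = x) ->
  (forall y, dom T y -> nm y <= c * nm (T y - z *: y)) ->
  ~ spectrum T z /\ op_bound (resolvent T z) c.
Proof.
move=> c0 surj bnd.
have inj x y : dom T x -> dom T y -> T x - z *: x = T y - z *: y -> x = y.
  move=> hx hy xy; apply/eqP; rewrite -subr_eq0; apply/eqP/nm_le0.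
  apply: le_trans (bnd _ (domB hx hy)) _.
  by rewrite op_linB // scalerBr opprD addrACA -(opprD (T y)) xy subrr nm0 mulr0.
have resK x : dom T (resolvent T z x) /\ T (resolvent T z x) - z *: resolvent T z x = x.
  have [y hy yx] := surj x.
  exact: (@xgetPex _ 0 [set y | dom T y /\ op_shift T z y = x] (ex_intro _ y (conj hy yx))).
have resb : op_bound (resolvent T z) c.
  by move=> x; have [h1 h2] := resK x; have := bnd _ h1; rewrite h2.
split=> //; apply; split.
  split=> //; first by move=> x y /set_mem hx /set_mem hy; exact: inj.
  by move=> x _; have [y] := surj x; exists y.
apply/bounded_opP; split; last by exists c.
move=> a x y; have [hx ex] := resK x; have [hy ey] := resK y.
have [hxy exy] := resK (a *: x + y).
apply: inj => //; first exact: dom_linear.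
rewrite exy op_linear // -{1}ex -{1}ey scalerBr scalerDr !scalerA (mulrC z).
by rewrite opprD addrACA.
Qed.

End Generic.

(** On Dom(T), T - z = (1 - (z - w) R(w)) (T - w). The operator (z - w) R(w) has norm at most 1/2,
    so the first factor is inverted by a Neumann series, at the cost of a factor 2. *)
Lemma resolvent_open (X : completeNormedModType C) (T : unbounded_op X) w z c :
  ~ spectrum T w -> 0 <= c -> op_bound (resolvent T w) c -> nm (z - w) * c <= 1 / 2 ->
  ~ spectrum T z /\ op_bound (resolvent T z) (2 * c).
Proof.
move=> hw c0 hc zw.
have shift y : T y - z *: y = (T y - w *: y) - (z - w) *: y.
  by rewrite scalerBl opprB addrA subrK.
apply: spectrumN; first by rewrite mulr_ge0.
  move=> x; pose K y := (z - w) *: resolvent T w y.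
  have KL : linear K.
    by move=> a u v; rewrite /K resolvent_linear // scalerDr !scalerA mulrC.
  have [|||u hu] := @neumann _ X K (1 / 2) KL _ _ _ x.
  - move=> y; rewrite /K nmZ; apply: le_trans (ler_wpM2l (nm_ge0 _) (hc y)) _.
    by rewrite mulrA ler_wpM2r ?nm_ge0.
  - by rewrite divr_ge0.
  - by rewrite ltr_pdivrMr // mul1r ltr1n.
  exists (resolvent T w u); first exact: resolvent_dom.
  by rewrite shift (resolventK hw u).2 {1}hu addrK.
move=> y hy; have := hc (T y - w *: y).
have -> : resolvent T w (T y - w *: y) = y by exact: resolvent_eq.
have -> : T y - w *: y = (T y - z *: y) + (z - w) *: y by rewrite shift subrK.
(* |y| <= c |(T - z) y| + c |z - w| |y|, and the last term, at most |y| / 2, is absorbed on the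
   left. *)
move=> h; have := ler_wpM2l c0 (nmD (T y - z *: y) ((z - w) *: y)).
rewrite nmZ => h2; have := le_trans h h2; have := ler_wpM2r (nm_ge0 y) zw.
by set a := nm y; set b := nm (_ - z *: _); nra.
Qed.

(** Connectedness of [a, b], through the supremum of the t such that P holds on all of [a, t]. The
    local hypothesis only transfers P from one point near t to another, which is the form in which
    local constancy is available later. *)
Lemma path_ind (P : R -> Prop) (a b : R) : a <= b ->
  (forall t, a <= t <= b -> exists2 d, 0 < d & forall s s', a <= s <= b -> a <= s' <= b ->
     `|s - t| < d -> `|s' - t| < d -> P s -> P s') ->
  P a -> P b.
Proof.
move=> ab loc Pa; pose S := [set t | a <= t <= b /\ forall s, a <= s <= t -> P s].
have Sa : S a.
  by split=> [|s]; [rewrite lexx|rewrite -eq_le => /eqP <-].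
have hS : has_sup S by split; [exists a|exists b => t [/andP[]]].
have supa : a <= sup S by apply: ub_le_sup => //; case: hS.
have supb : sup S <= b by apply: ge_sup; [exists a|move=> t [/andP[]]].
have /andP/loc[d d0 hd] : a <= sup S /\ sup S <= b by split.
have [t [/andP[ta tb] St] tsup] := sup_adherent d0 hS.
have tS : t <= sup S by apply: ub_le_sup; [case: hS|split=> //; rewrite ta].
have near_P s : a <= s <= b -> `|s - sup S| < d -> P s.
  move=> hs sd; apply: (hd t) => //; first by rewrite ta.
    by rewrite ler0_norm ?subr_le0 // opprB ltrBlDr -ltrBlDl.
  by apply: St; rewrite ta lexx.
(* Either b is within reach of the supremum, or [S] contains sup S + d / 2, which is absurd. *)
have [bd|bd] := ltP b (sup S + d).
  by apply: near_P; [rewrite ab lexx|rewrite ger0_norm ?subr_ge0 // ltrBlDl].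
have : S (sup S + d / 2).
  split=> [|s /andP[sa sb]]; first by apply/andP; split; nra.
  have [st|ts] := leP s t; first by apply: St; rewrite sa.
  by apply: near_P; [apply/andP; split; nra|rewrite ltr_norml; apply/andP; split; nra].
by move/(ub_le_sup hS.2); rewrite gerDl leNgt divr_gt0.
Qed.

(** Compactness of [a, b] obtained from [path_ind]: the property propagated is that a common bound
    exists on [a, b'], and one more local bound is absorbed by a maximum. *)
Lemma locally_bounded (P : R -> R -> Prop) (a b : R) : a <= b ->
  (forall t c d, c <= d -> P t c -> P t d) ->
  (forall t, a <= t <= b -> exists d M, 0 < d /\ forall s, a <= s <= b ->
     `|s - t| < d -> P s M) ->
  exists M, forall t, a <= t <= b -> P t M.
Proof.
move=> ab mono loc.
apply: (@path_ind (fun b' => exists M, forall t, a <= t <= b' -> P t M) a b ab).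
  move=> t /loc[d [M [d0 hM]]]; exists d => // s s' hs hs' sd sd' [M' hM'].
  exists (Num.max M M') => r /andP[ra rs'].
  have [rs|sr] := leP r s.
    by apply: mono (hM' r _); [rewrite le_max lexx orbT|rewrite ra].
  apply: mono (hM r _ _); first by rewrite le_max lexx.
    by rewrite ra (le_trans rs') //; case/andP: hs'.
  move: sd sd'; rewrite !ltr_norml => /andP[? ?] /andP[? ?].
  by apply/andP; split; lra.
have /loc[d [M [d0 hM]]] : a <= a <= b by rewrite lexx.
exists M => t; rewrite -eq_le => /eqP <-.
by apply: hM; rewrite ?lexx // subrr normr0.
Qed.

Lemma resolvent_path_bounded (X : completeNormedModType C) (T : unbounded_op X)
    (gam : R -> C) (k a b : R) : a <= b -> 0 <= k ->
  (forall s t, a <= s <= b -> a <= t <= b -> nm (gam s - gam t) <= k * `|s - t|) ->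
  (forall t, a <= t <= b -> ~ spectrum T (gam t)) ->
  exists2 M, 0 <= M & forall t, a <= t <= b -> op_bound (resolvent T (gam t)) M.
Proof.
move=> ab k0 kl reg.
have [||M hM] := @locally_bounded
    (fun t c => op_bound (resolvent T (gam t)) c) a b ab.
- by move=> t c d; exact: op_bound_le.
- move=> t ht; have tT := reg _ ht; have [c c0 hc] := resolvent_bounded tT.
  (* For |s - t| below the inverse of this number, k |s - t| c <= 1/2, the condition of
     [resolvent_open]. *)
  have h : 0 < 2 * (k * c + 1) by rewrite mulr_gt0 // ltr_wpDl // mulr_ge0.
  exists (2 * (k * c + 1))^-1, (2 * c); split; first by rewrite invr_gt0.
  move=> s hs st; apply: (resolvent_open tT c0 hc _).2.
  apply: le_trans (ler_wpM2r c0 (kl s t hs ht)) _.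
  rewrite mulrAC; move: st; rewrite -div1r ltr_pdivlMr // => st.
  by have := normr_ge0 (s - t); have := mulr_ge0 k0 c0; nra.
- by exists (Num.max 0 M) => [|t /hM]; [rewrite le_max lexx|apply: op_bound_le; rewrite le_max lexx orbT].
Qed.

End Resolvent.

(** * The complex exponential and sums over roots of unity *)

Section ExpSums.

(** Taylor polynomial of the exponential, over a general field so that a remainder at a complex x
    can be compared with the same expression at the real number |x|. *)
Definition exp_sum (F : numFieldType) (J : nat) (x : F) : F :=
  \sum_(0 <= j < J) x ^+ j / j`!%:R.

(** By the binomial formula, the terms with a + b = j add up to (x + v)^j / j!. *)
Lemma exp_sum_diag (F : numFieldType) J (x v : F) :
  exp_sum J (x + v) =
  \sum_(0 <= a < J) \sum_(0 <= b < J - a) (x ^+ a / a`!%:R) * (v ^+ b / b`!%:R).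
Proof.
elim: J => [|J IH]; first by rewrite /exp_sum !big_nil.
rewrite /exp_sum big_nat_recr //= -/(exp_sum J _) IH.
rewrite [RHS](eq_big_nat _ _ (F2 := fun a =>
  \sum_(0 <= b < J - a) (x ^+ a / a`!%:R) * (v ^+ b / b`!%:R)
  + (x ^+ a / a`!%:R) * (v ^+ (J - a) / (J - a)`!%:R))); last first.
  by move=> a /andP[_ aJ]; rewrite subSn // big_nat_recr.
rewrite big_split /= [X in _ = X + _]big_nat_recr //= subnn big_nil addr0.
congr (_ + _); rewrite addrC exprDn mulr_suml big_mkord; apply: eq_bigr => a _.
have aJ : (a <= J)%N by rewrite -ltnS.
rewrite -(bin_fact aJ) !natrM -mulr_natr mulrC.
have h n : n`!%:R != 0 :> F by rewrite pnatr_eq0 -lt0n fact_gt0.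
have hb : 'C(J, a)%:R != 0 :> F by rewrite pnatr_eq0 -lt0n bin_gt0.
by field; rewrite !h hb.
Qed.

(** What remains of the product is the triangle a + b >= J. Its terms are nonnegative at nonnegative
    reals, so the complex remainder is dominated by the one at |x|, |v|, which tends to e^|x| e^|v|
    - e^(|x| + |v|) = 0. *)
Lemma exp_sumM (F : numFieldType) J (x v : F) :
  exp_sum J x * exp_sum J v - exp_sum J (x + v) =
  \sum_(0 <= a < J) \sum_(J - a <= b < J) (x ^+ a / a`!%:R) * (v ^+ b / b`!%:R).
Proof.
rewrite exp_sum_diag {1}/exp_sum mulr_suml -sumrB; apply: eq_bigr => a _.
rewrite /exp_sum mulr_sumr (@big_cat_nat _ _ _ (J - a)%N 0%N J) ?leq_subr //=.
by rewrite addrAC subrr add0r.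
Qed.

End ExpSums.

Section ComplexExp.
Context {R : realType}.
Local Notation C := R[i].

Lemma nm_nat n : nm (n%:R : C) = n%:R.
Proof. by rewrite /nm normr_nat -(rmorph_nat (@real_complex R)). Qed.

Lemma nm_exp_term (x : C) a : nm (x ^+ a / a`!%:R) = nm x ^+ a / a`!%:R.
Proof. by rewrite nmM nmX nmV nm_nat. Qed.

Lemma exp_sum_series (x : R) : (fun J => exp_sum J x) = series (exp_coeff x).
Proof. by apply/funext => J; rewrite /exp_sum /series /=. Qed.

Lemma exp_sum_cvg (x : R) : (fun J => exp_sum J x) @ \oo --> expR x.
Proof. by rewrite exp_sum_series; exact: is_cvg_series_exp_coeff. Qed.

Lemma exp_sumR J (x : R) : exp_sum J x%:C = (exp_sum J x)%:C :> C.
Proof.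
rewrite /exp_sum rmorph_sum; apply: eq_bigr => j _.
by rewrite rmorphM rmorphXn fmorphV rmorph_nat.
Qed.

Lemma exp_sum_tail (x : C) J J' : (J <= J')%N ->
  nm (exp_sum J' x - exp_sum J x) <= exp_sum J' (nm x) - exp_sum J (nm x).
Proof.
move=> JJ; rewrite /exp_sum !(@big_cat_nat _ _ _ J 0%N J') //= !(addrC (\sum_(0 <= _ < J) _)) !addrK.
apply: le_trans (nm_sum _ _ _) _.
by apply: ler_sum => j _; have /eqP := nm_exp_term x j; rewrite eq_le => /andP[].
Qed.

Lemma exp_sumD_tends (x v : C) lx lv :
  tends (fun J => exp_sum J x) lx -> tends (fun J => exp_sum J v) lv ->
  tends (fun J => exp_sum J (x + v)) (lx * lv).
Proof.
move=> hx hv.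
have hxv : tends (fun J => exp_sum J x * exp_sum J v) (lx * lv).
  exact: (@tendsZ _ R[i]^o _ _ _ _ hx hv).
have hd : tends (fun J => exp_sum J (x + v) - exp_sum J x * exp_sum J v) (0 : C).
  apply: (@tends_le _ _ _ _ (fun J => exp_sum J (nm x) * exp_sum J (nm v)
      - exp_sum J (nm x + nm v))).
    near=> J; rewrite subr0 nmBC !exp_sumM; apply: le_trans (nm_sum _ _ _) _.
    apply: ler_sum => a _; apply: le_trans (nm_sum _ _ _) _.
    apply: ler_sum => b _; rewrite nmM.
    by have <- := nm_exp_term x a; have <- := nm_exp_term v b.
  rewrite -[X in _ --> X](subrr (expR (nm x + nm v))) {1}expRD.
  by apply: cvgB; [apply: cvgM|]; exact: exp_sum_cvg.
have := tendsD hd hxv; rewrite add0r.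
by under eq_fun do rewrite subrK.
Unshelve. all: by end_near. Qed.

Lemma tends_ReIm (u : nat -> R[i]) (l : R[i]) :
  (fun n => complex.Re (u n)) @ \oo --> complex.Re l ->
  (fun n => complex.Im (u n)) @ \oo --> complex.Im l -> tends u l.
Proof.
move=> hr hi.
apply: (@tends_le _ _ _ _ (fun n => `|complex.Re (u n) - complex.Re l| +
   `|complex.Im (u n) - complex.Im l|)).
  near=> n; apply: le_trans (nm_ReIm _) _.
  by case: (u n) => a b; case: (l) => c d.
rewrite -[X in _ --> X](addr0 (0 : R)); apply: cvgD.
  rewrite -(@normr0 _ R) -(subrr (complex.Re l)); apply: cvg_norm; apply: cvgB => //.
  exact: cvg_cst.
rewrite -(@normr0 _ R) -(subrr (complex.Im l)); apply: cvg_norm; apply: cvgB => //.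
exact: cvg_cst.
Unshelve. all: by end_near. Qed.

Lemma exp_sum_Im (y : R) J : exp_sum J (0 +i* y) =
  series (cos_coeff y) J +i* series (sin_coeff y) J.
Proof.
rewrite /exp_sum /series /=; elim: J => [|J IH]; first by rewrite !big_nil.
rewrite !big_nat_recr //= {}IH.
have -> : (0 +i* y) ^+ J / J`!%:R = cos_coeff y J +i* sin_coeff y J.
  have -> : 0 +i* y = 'i%C * y%:C :> C.
    by apply/eqP; rewrite eq_complex /=; apply/andP; split; apply/eqP; ring.
  rewrite exprMn -rmorphXn -(rmorph_nat (@real_complex R)) -fmorphV -mulrA -rmorphM /=.
  have -> : 'i%C ^+ J = ((~~ odd J)%:R * (-1) ^+ J./2) +i* ((odd J)%:R * (-1) ^+ J.-1./2) :> C.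
    rewrite -{1}(odd_double_half J) exprD -mul2n exprM sqr_i.
    have -> : (odd J)%:R * (-1) ^+ J.-1./2 = (odd J)%:R * (-1) ^+ J./2 :> R.
      case: (boolP (odd J)) => oJ; last by rewrite !mul0r.
      congr (_ * _ ^+ _); case: J oJ => //= m om.
      by rewrite uphalf_half (negPf om).
    rewrite -(rmorphN1 (@real_complex R)) -rmorphXn.
    case: (odd J) => /=; rewrite ?expr1 ?expr0;
      by apply/eqP; rewrite eq_complex /=; apply/andP; split; apply/eqP; ring.
  by apply/eqP; rewrite eq_complex /=; apply/andP; split; apply/eqP; rewrite ?cos_coeffE /sin_coeff /=; ring.
by [].
Qed.

Lemma exp_sum_tends (z : C) : tends (fun J => exp_sum J z) (expC z).
Proof.
have zE : z = (complex.Re z)%:C + (0 +i* complex.Im z).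
  by case: z => u v; apply/eqP; rewrite eq_complex /= addr0 add0r !eqxx.
rewrite {1}zE; apply: exp_sumD_tends.
  apply: tends_ReIm => /=.
    under eq_fun do rewrite exp_sumR /=; exact: exp_sum_cvg.
  under eq_fun do rewrite exp_sumR /=; exact: cvg_cst.
apply: tends_ReIm => /=.
  under eq_fun do rewrite exp_sum_Im /=.
  by rewrite unlock; exact: is_cvg_series_cos_coeff.
under eq_fun do rewrite exp_sum_Im /=.
by rewrite unlock; exact: is_cvg_series_sin_coeff.
Qed.

(** The remainder is dominated termwise by the real remainder at K. The uniformity in z is what
    allows the exponential series to be exchanged with a contour integral. *)
Lemma exp_sum_unif (z : C) (K : R) J : nm z <= K ->
  nm (expC z - exp_sum J z) <= expR K - exp_sum J K.
Proof.
move=> zK.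
have mono J' : (J <= J')%N -> nm (exp_sum J' z - exp_sum J z) <= exp_sum J' K - exp_sum J K.
  move=> JJ; apply: le_trans (exp_sum_tail _ JJ) _.
  rewrite /exp_sum !(@big_cat_nat _ _ _ J 0%N J') //= !(addrC (\sum_(0 <= _ < J) _)) !addrK.
  apply: ler_sum => j _; rewrite ler_wpM2r ?invr_ge0 ?ler0n //.
  by rewrite lerXn2r // nnegrE ?nm_ge0 // (le_trans (nm_ge0 z)).
apply: (@tends_nm_le _ _ (fun J' => exp_sum J' z - exp_sum J z) _
   (fun J' => exp_sum J' K - exp_sum J K)).
- by apply: tendsD; [exact: exp_sum_tends|exact: tends_cst].
- by apply: cvgB; [exact: exp_sum_cvg|exact: cvg_cst].
- by exists J => // J' /= /mono.
Qed.

Lemma expC0 : expC (0 : C) = 1.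
Proof. by rewrite /expC /= expR0 cos0 sin0 mul1r. Qed.

Lemma expCD (z w : C) : expC (z + w) = expC z * expC w.
Proof.
case: z w => a b [c d]; rewrite /expC /= expRD cosD sinD.
by apply/eqP; rewrite eq_complex /=; apply/andP; split; apply/eqP; ring.
Qed.

Lemma exp_sum_lip (z w : C) (K : R) J : nm z <= K -> nm w <= K ->
  nm (exp_sum J z - exp_sum J w) <= exp_sum J K * nm (z - w).
Proof.
move=> zK wK; have K0 : 0 <= K by apply: le_trans zK; exact: nm_ge0.
have powlip j : nm (z ^+ j.+1 - w ^+ j.+1) <= j.+1%:R * K ^+ j * nm (z - w).
  elim: j => [|j IH]; first by rewrite !expr1 expr0 !mul1r.
  have -> : z ^+ j.+2 - w ^+ j.+2 = z * (z ^+ j.+1 - w ^+ j.+1) + (z - w) * w ^+ j.+1.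
    by rewrite (exprS z j.+1) (exprS w j.+1); ring.
  apply: le_trans (nmD _ _) _; rewrite !nmM nmX.
  have h1 : nm z * nm (z ^+ j.+1 - w ^+ j.+1) <= K * (j.+1%:R * K ^+ j * nm (z - w)).
    by apply: ler_pM; rewrite ?nm_ge0.
  have h2 : nm (z - w) * nm w ^+ j.+1 <= nm (z - w) * K ^+ j.+1.
    by rewrite ler_wpM2l ?nm_ge0 // lerXn2r // nnegrE ?nm_ge0.
  apply: le_trans (lerD h1 h2) _; rewrite le_eqVlt; apply/orP; left; apply/eqP.
  by rewrite -(natr1 j.+1) exprS; ring.
rewrite /exp_sum -sumrB; apply: le_trans (nm_sum _ _ _) _; rewrite mulr_suml.
(* The constant terms cancel and j K^(j-1) / j! = K^(j-1) / (j-1)!, so J + 1 terms yield exactly the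
   J terms of [exp_sum J K]. *)
have drop1 : \sum_(0 <= j < J) nm (z ^+ j / j`!%:R - w ^+ j / j`!%:R) <=
  \sum_(0 <= j < J.+1) nm (z ^+ j / j`!%:R - w ^+ j / j`!%:R).
  by rewrite [leRHS]big_nat_recr //= lerDl nm_ge0.
apply: le_trans drop1 _; rewrite big_nat_recl // !expr0 subrr nm0 add0r.
apply: ler_sum => j _; rewrite -mulrBl nmM nmV nm_nat factS natrM invfM mulrCA.
have j0 : 0 < j.+1%:R :> R by rewrite ltr0n.
apply: le_trans (ler_wpM2l _ (ler_wpM2r _ (powlip j))) _; rewrite ?invr_ge0 ?ler0n //.
rewrite le_eqVlt; apply/orP; left; apply/eqP.
by field; rewrite pnatr_eq0 -lt0n fact_gt0 /= gt_eqF.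
Qed.

Lemma expC_lip (z w : C) (K : R) : nm z <= K -> nm w <= K ->
  nm (expC z - expC w) <= expR K * nm (z - w).
Proof.
move=> zK wK.
apply: (@tends_nm_le _ _ (fun J => exp_sum J z - exp_sum J w) _
   (fun J => exp_sum J K * nm (z - w))).
- apply: tendsD; first exact: exp_sum_tends.
  exact/tendsN/exp_sum_tends.
- by apply: cvgM; [exact: exp_sum_cvg|exact: cvg_cst].
- by near=> J; exact: exp_sum_lip.
Unshelve. all: by end_near. Qed.

End ComplexExp.

Section Circle.
Context {R : realType}.
Local Notation C := R[i].

Lemma nm_circle_point (r t : R) : nm (circle_point r t) = `|r|.
Proof.
rewrite /circle_point nmM nmR /expC /= expR0 mul1r.
by rewrite [nm (_ +i* _)]/nm normc_def /= cos2Dsin2 sqrtr1 mulr1.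
Qed.

(** The factor e^b is crude (1 would do); it comes directly from [expC_lip], and any Lipschitz
    constant is enough for the Riemann sums. *)
Lemma circle_point_lip (r s t b : R) : 0 <= s <= b -> 0 <= t <= b ->
  nm (circle_point r s - circle_point r t) <= `|r| * expR b * `|s - t|.
Proof.
move=> /andP[s0 sb] /andP[t0 tb].
rewrite /circle_point -mulrBr nmM nmR -mulrA ler_wpM2l //.
have nI (x : R) : nm (0 +i* x) = `|x|.
  by rewrite /nm normc_def /= expr0n add0r sqrtr_sqr.
have := @expC_lip _ (0 +i* s) (0 +i* t) b.
have -> : 0 +i* s - (0 +i* t) = 0 +i* (s - t) :> C.
  by apply/eqP; rewrite eq_complex /= subrr !eqxx.
by rewrite !nI (ger0_norm s0) (ger0_norm t0); apply.
Qed.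

Lemma circle_pointX (r t : R) l :
  circle_point r t ^+ l = circle_point (r ^+ l) (t * l%:R).
Proof.
rewrite /circle_point exprMn rmorphXn; congr (_ * _).
elim: l => [|l IH]; first by rewrite mulr0 expC0.
rewrite exprS IH -expCD; congr expC.
by apply/eqP; rewrite eq_complex /= addr0 eqxx /= -natr1 mulrDr mulr1 addrC.
Qed.

Definition root_pt (N : nat) (r : R) (j : nat) : C :=
  circle_point r (j%:R * (2 * pi) / N%:R).

Lemma root_ptX N r j : (0 < N)%N -> root_pt N r j ^+ N = (r ^+ N)%:C.
Proof.
move=> N0; rewrite /root_pt circle_pointX mulfVK ?pnatr_eq0 -?lt0n //.
rewrite /circle_point -[RHS]mulr1; congr (_ * _).
elim: j => [|j IH]; first by rewrite mul0r expC0.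
rewrite -natr1 mulrDl mul1r.
have -> : 0 +i* (j%:R * (2 * pi) + 2 * pi) = (0 +i* (j%:R * (2 * pi))) + (0 +i* (2 * pi)) :> C.
  by apply/eqP; rewrite eq_complex /= addr0 !eqxx.
rewrite expCD IH mul1r /expC /= expR0 mulr_natl cos2pi sin2pi mul1r.
by apply/eqP; rewrite eq_complex /= !eqxx.
Qed.

Lemma sum_root_ptX N r l : (0 < l < N)%N -> \sum_(j < N) root_pt N r j ^+ l = 0.
Proof.
move=> /andP[l0 lN]; have N0 : (0 < N)%N by apply: leq_ltn_trans lN.
have NR : 0 < N%:R :> R by rewrite ltr0n.
pose q := expC (0 +i* (l%:R * (2 * pi) / N%:R)) : C.
have E j : root_pt N r j ^+ l = (r ^+ l)%:C * q ^+ j.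
  rewrite /root_pt circle_pointX /circle_point; congr (_ * _).
  have -> : q = circle_point 1 (l%:R * (2 * pi) / N%:R) by rewrite /circle_point mul1r.
  rewrite circle_pointX expr1n /circle_point mul1r; congr (expC (_ +i* _)); ring.
under eq_bigr do rewrite E.
rewrite -mulr_sumr.
have qN : q ^+ N = 1.
  have := E N; rewrite /root_pt.
  have := @root_ptX N 1 l N0; rewrite /root_pt /circle_point mul1r -/q => ->.
  by rewrite expr1n.
(* The real part of q is cos(2 x) = 1 - 2 sin(x)^2 with x = l pi / N in (0, pi), hence less than
   1. *)
have q1 : q != 1.
  rewrite /q /expC /= expR0 mul1r eq_complex /= negb_and; apply/orP; left.
  have hx : (0 : R) < l%:R * (pi : R) / N%:R < (pi : R).
    apply/andP; split; first by rewrite divr_gt0 // mulr_gt0 ?pi_gt0 ?ltr0n.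
    by rewrite ltr_pdivrMr // mulrC ltr_pM2l ?pi_gt0 // ltr_nat.
  have s0 := sin_gt0_pi hx.
  have -> : l%:R * (2 * pi) / N%:R = (l%:R * pi / N%:R) *+ 2 :> R by rewrite -mulr_natl; ring.
  rewrite cos_mulr2n cos2sin2; apply/eqP => h.
  have := exprn_gt0 2 s0; rewrite -mulr_natl in h; lra.
have : (q - 1) * \sum_(j < N) q ^+ j = 0 by rewrite -subrX1 qN subrr.
by move/eqP; rewrite mulf_eq0 subr_eq0 (negPf q1) /= => /eqP ->; rewrite mulr0.
Qed.

(* An equidistant Riemann sum of the Cauchy kernel z / (z - w) over |z| = r. *)
Lemma sum_root_pt_cauchy N r (w : C) : (0 < N)%N -> w ^+ N != (r ^+ N)%:C ->
  \sum_(j < N) root_pt N r j / (root_pt N r j - w) =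
  N%:R * (r ^+ N)%:C / ((r ^+ N)%:C - w ^+ N).
Proof.
move=> N0 wN; have D0 : (r ^+ N)%:C - w ^+ N != 0 by rewrite subr_eq0 eq_sym.
have vw j : root_pt N r j - w != 0.
  by apply: contra_neq wN => /eqP; rewrite subr_eq0 => /eqP <-; rewrite root_ptX.
(* All sample points have the same N-th power r^N, so factoring r^N - w^N expands the kernel into
   powers of the sample point with exponents N - l between 1 and N. Summed over j, only l = 0
   survives. *)
have E j : root_pt N r j / (root_pt N r j - w) =
    (\sum_(l < N) root_pt N r j ^+ (N - l) * w ^+ l) / ((r ^+ N)%:C - w ^+ N).
  apply: (canRL (mulfK D0)); rewrite -(root_ptX r j N0) subrXX mulrA mulfVK //.
  rewrite mulr_sumr; apply: eq_bigr => l _.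
  rewrite mulrA -exprS; congr (_ ^+ _ * _); have := ltn_ord l; lia.
under eq_bigr do rewrite E.
rewrite -mulr_suml; congr (_ / _); rewrite exchange_big /=.
case: N N0 {wN D0 vw E} => // N _; rewrite big_ord_recl /= [X in _ + X]big1 ?addr0.
  under eq_bigr do rewrite expr0 mulr1 subn0 root_ptX //.
  by rewrite sumr_const card_ord mulr_natl.
move=> l _; rewrite -mulr_suml sum_root_ptX ?mul0r //.
by rewrite /bump /= add1n subSS subn_gt0 ltn_ord ltnS leq_subr.
Qed.

End Circle.

(** * Riemann integrals of operators *)

Section RiemannSums.
Context {R : realType}.
Local Notation C := R[i].

Definition clamp (lo hi x : R) : R := Num.max lo (Num.min hi x).

Lemma clampP (lo hi x : R) : lo <= hi ->
  [\/ x <= lo /\ clamp lo hi x = lo, lo <= x <= hi /\ clamp lo hi x = x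
    | hi <= x /\ clamp lo hi x = hi].
Proof.
move=> lh; rewrite /clamp; case: (ltP x lo) => lx.
  by constructor 1; rewrite (min_r (le_trans (ltW lx) lh)) (max_l (ltW lx)) ltW.
case: (leP x hi) => xh; last by constructor 3; rewrite (max_r lh) ltW.
by constructor 2; rewrite (max_r lx).
Qed.

(** Both sides are the length of the intersection of [A, B] and [c, d]. *)
Lemma clamp_overlap (A B c d : R) : A <= B -> c <= d ->
  clamp A B d - clamp A B c = clamp c d B - clamp c d A.
Proof.
move=> AB cd; case: (clampP d AB) => -[h1 ->]; case: (clampP c AB) => -[h2 ->];
  case: (clampP A cd) => -[h3 ->]; case: (clampP B cd) => -[h4 ->]; lra.
Qed.

Lemma clamp_overlap_ge0 (A B c d : R) : A <= B -> c <= d ->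
  0 <= clamp A B d - clamp A B c.
Proof.
move=> AB cd; case: (clampP d AB) => -[h1 ->]; case: (clampP c AB) => -[h2 ->]; lra.
Qed.

Lemma clamp_overlap_gt0 (A B c d : R) : A <= B -> c <= d ->
  0 < clamp A B d - clamp A B c -> A <= d /\ c <= B.
Proof.
move=> AB cd; case: (clampP d AB) => -[h1 ->]; case: (clampP c AB) => -[h2 ->] h;
  split; lra.
Qed.

Lemma telescope (p : nat -> R) m : \sum_(i < m) (p i.+1 - p i) = p m - p 0%N.
Proof. by rewrite -(big_mkord xpredT (fun i => p i.+1 - p i)) telescope_sumr. Qed.

Lemma steps_le (p : nat -> R) m : (forall i, (i < m)%N -> p i <= p i.+1) ->
  forall i, (i <= m)%N -> p 0%N <= p i <= p m.
Proof.
move=> st i im; apply/andP; split.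
  by elim: i im => // i IH im; apply: le_trans (st _ im); apply: IH; exact: ltnW.
elim: m st im => [|m IH] st; first by rewrite leqn0 => /eqP ->.
rewrite leq_eqVlt => /orP[/eqP -> //|im]; apply: le_trans (IH _ im) (st _ _) => // j jm.
by apply: st; exact: ltnW.
Qed.

(** Both sums are rewritten over all pairs of cells, weighted by the length [o i j] of their
    overlap; this stands in for a common refinement. When the overlap is positive the two cells
    meet, so their tags are at most d + d' apart, and the overlaps add up to b - a. *)
Lemma riemann_compare (Y : normedModType C) (G : R -> Y) (a b K d d' : R)
    (p q tau sig : nat -> R) m m' :
  0 <= K -> 0 <= d -> 0 <= d' ->
  (forall s t, a <= s <= b -> a <= t <= b -> nm (G s - G t) <= K * `|s - t|) ->
  p 0%N = a -> p m = b -> q 0%N = a -> q m' = b ->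
  (forall i, (i < m)%N -> [/\ p i <= tau i, tau i <= p i.+1 & p i.+1 - p i <= d]) ->
  (forall i, (i < m')%N -> [/\ q i <= sig i, sig i <= q i.+1 & q i.+1 - q i <= d']) ->
  nm (\sum_(i < m) (p i.+1 - p i)%:C *: G (tau i)
    - \sum_(j < m') (q j.+1 - q j)%:C *: G (sig j)) <= (b - a) * (K * (d + d')).
Proof.
move=> K0 d0 d'0 lipG p0 pm q0 qm hp hq.
have sp i : (i < m)%N -> p i <= p i.+1 by case/hp => h1 h2 _; exact: le_trans h2.
have sq i : (i < m')%N -> q i <= q i.+1 by case/hq => h1 h2 _; exact: le_trans h2.
have bp := steps_le sp; have bq := steps_le sq; rewrite p0 pm in bp; rewrite q0 qm in bq.
have ab : a <= b by have /andP[h1 h2] := bp 0%N isT; exact: le_trans h2.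
pose o i j := clamp (p i) (p i.+1) (q j.+1) - clamp (p i) (p i.+1) (q j).
have clampL (A B : R) : a <= A -> A <= B -> clamp A B a = A.
  by move=> h1 h2; case: (clampP a h2) => -[h3 ->]; lra.
have clampR (A B : R) : B <= b -> A <= B -> clamp A B b = B.
  by move=> h1 h2; case: (clampP b h2) => -[h3 ->]; lra.
have so i : (i < m)%N -> \sum_(j < m') o i j = p i.+1 - p i.
  move=> im; rewrite (telescope (fun j => clamp (p i) (p i.+1) (q j))) q0 qm.
  have /andP[h1 _] := bp _ (ltnW im); have /andP[_ h2] := bp _ im.
  by rewrite clampL ?clampR //; exact: sp.
have so' j : (j < m')%N -> \sum_(i < m) o i j = q j.+1 - q j.
  move=> jm; rewrite (eq_bigr (fun i : 'I_m => clamp (q j) (q j.+1) (p i.+1)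
     - clamp (q j) (q j.+1) (p i))); last first.
    by move=> i _; rewrite /o clamp_overlap //; [exact: sp|exact: sq].
  rewrite (telescope (fun i => clamp (q j) (q j.+1) (p i))) p0 pm.
  have /andP[h1 _] := bq _ (ltnW jm); have /andP[_ h2] := bq _ jm.
  by rewrite clampL ?clampR //; exact: sq.
have -> : \sum_(i < m) (p i.+1 - p i)%:C *: G (tau i)
    = \sum_(i < m) \sum_(j < m') (o i j)%:C *: G (tau i).
  by apply: eq_bigr => i _; rewrite -scaler_suml -(rmorph_sum (@real_complex R)) so.
have -> : \sum_(j < m') (q j.+1 - q j)%:C *: G (sig j)
    = \sum_(i < m) \sum_(j < m') (o i j)%:C *: G (sig j).
  rewrite exchange_big /=; apply: eq_bigr => j _.
  by rewrite -scaler_suml -(rmorph_sum (@real_complex R)) so'.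
have -> : (b - a) * (K * (d + d')) = \sum_(i < m) \sum_(j < m') o i j * (K * (d + d')).
  rewrite -p0 -pm -(telescope p) mulr_suml; apply: eq_bigr => i _.
  by rewrite -mulr_suml so.
rewrite -sumrB; apply: le_trans (nm_sum _ _ _) _; apply: ler_sum => i _.
rewrite -sumrB; apply: le_trans (nm_sum _ _ _) _; apply: ler_sum => j _.
have o0 : 0 <= o i j by apply: clamp_overlap_ge0; [exact: sp|exact: sq].
rewrite -scalerBr nmZ nmR ger0_norm //.
have [oz|on] := eqVneq (o i j) 0; first by rewrite oz !mul0r.
have op : 0 < o i j by rewrite lt_neqAle eq_sym on.
have [c1 c2] := clamp_overlap_gt0 (sp _ (ltn_ord i)) (sq _ (ltn_ord j)) op.
rewrite ler_pM2l //.
have [t1 t2 t3] := hp _ (ltn_ord i); have [s1 s2 s3] := hq _ (ltn_ord j).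
have /andP[u1 u2] := bp _ (ltnW (ltn_ord i)); have /andP[u3 u4] := bp _ (ltn_ord i).
have /andP[v1 v2] := bq _ (ltnW (ltn_ord j)); have /andP[v3 v4] := bq _ (ltn_ord j).
apply: le_trans (lipG _ _ _ _) _; [by apply/andP; split; lra..|].
rewrite ler_wpM2l // ler_norml; apply/andP; split; lra.
Qed.

End RiemannSums.

Section OperatorIntegral.
Context {R : realType}.
Local Notation C := R[i].
Variables (X : normedModType C) (Y : completeNormedModType C).
Variables (F : R -> X -> Y) (a b K M : R).
Hypotheses (ab : a < b) (K0 : 0 <= K) (M0 : 0 <= M).
Hypothesis F_lin : forall t, a <= t <= b -> linear (F t).
Hypothesis F_bound : forall t, a <= t <= b -> op_bound (F t) M.
Hypothesis F_lip : forall s t x, a <= s <= b -> a <= t <= b ->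
  nm (F s x - F t x) <= K * `|s - t| * nm x.

Definition grid (N j : nat) : R := a + j%:R * (b - a) / N%:R.

(** Left tags on an equidistant grid: on a circle these tags give the points [root_pt], where the
    exact summation formulas hold. *)
Definition equi_sum (N : nat) (x : X) : Y :=
  \sum_(j < N) ((b - a) / N%:R)%:C *: F (grid N j) x.

Lemma gridS N j : (0 < N)%N -> grid N j.+1 - grid N j = (b - a) / N%:R.
Proof.
by move=> N0; rewrite /grid -natr1; field; rewrite pnatr_eq0 -lt0n.
Qed.

Lemma grid_lt N j : (0 < N)%N -> grid N j < grid N j.+1.
Proof. by move=> N0; rewrite -subr_gt0 gridS // divr_gt0 ?subr_gt0 ?ltr0n. Qed.

Lemma grid0 N : grid N 0 = a.
Proof. by rewrite /grid !mul0r addr0. Qed.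

Lemma gridN N : (0 < N)%N -> grid N N = b.
Proof. by move=> N0; rewrite /grid; field; rewrite pnatr_eq0 -lt0n. Qed.

Lemma grid_in N j : (0 < N)%N -> (j <= N)%N -> a <= grid N j <= b.
Proof.
move=> N0 jN; have := @steps_le _ (grid N) N; rewrite grid0 gridN //.
by apply=> // i _; apply: ltW; exact: grid_lt.
Qed.

Lemma equi_sumE N x : (0 < N)%N ->
  equi_sum N x = \sum_(j < N) (grid N j.+1 - grid N j)%:C *: F (grid N j) x.
Proof. by move=> N0; apply: eq_bigr => j _; rewrite gridS. Qed.

Lemma equi_sum_compare (p tau : nat -> R) m d N x : (0 < N)%N -> 0 <= d ->
  p 0%N = a -> p m = b ->
  (forall i, (i < m)%N -> [/\ p i <= tau i, tau i <= p i.+1 & p i.+1 - p i <= d]) ->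
  nm (\sum_(i < m) (p i.+1 - p i)%:C *: F (tau i) x - equi_sum N x)
    <= (b - a) * K * (d + (b - a) / N%:R) * nm x.
Proof.
move=> N0 d0 p0 pm hp; rewrite equi_sumE //.
have -> : (b - a) * K * (d + (b - a) / N%:R) * nm x =
  (b - a) * ((K * nm x) * (d + (b - a) / N%:R)) by ring.
apply: (@riemann_compare _ _ (fun t => F t x)) => //.
- by rewrite mulr_ge0 // nm_ge0.
- by rewrite divr_ge0 // subr_ge0 ltW.
- by move=> s t hs ht; apply: le_trans (F_lip _ _ _) _ => //; rewrite mulrAC.
- exact: grid0.
- exact: gridN.
- by move=> i _; rewrite lexx gridS // lexx ltW // grid_lt.
Qed.

Lemma inv_cvg0 (c : R) : (fun n => c / n.+1%:R) @ \oo --> (0 : R).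
Proof.
rewrite -[X in _ --> X](mulr0 c); apply: cvgM; first exact: cvg_cst.
exact: cvg_harmonic.
Qed.

Lemma equi_sum_cvg x : exists l, tends (fun n => equi_sum n.+1 x) l.
Proof.
have [||l hl _] := @tends_cauchy _ _ (fun n => equi_sum n.+1 x)
    (fun n => (b - a) * K * (2 * (b - a)) * nm x / n.+1%:R); last by exists l.
  move=> n m nm'; rewrite {1}equi_sumE //.
  apply: le_trans (equi_sum_compare (d := (b - a) / n.+1%:R) x _ _ _ _ _) _ => //.
  - by rewrite divr_ge0 // subr_ge0 ltW.
  - exact: grid0.
  - exact: gridN.
  - by move=> i _; rewrite lexx gridS // lexx ltW // grid_lt.
  have h : (b - a) / m.+1%:R <= (b - a) / n.+1%:R.
    by rewrite ler_wpM2l // ?lef_pV2 ?posrE ?ltr0n ?ler_nat // subr_ge0 ltW.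
  have -> : (b - a) * K * (2 * (b - a)) * nm x / n.+1%:R =
    (b - a) * K * (2 * ((b - a) / n.+1%:R)) * nm x by ring.
  rewrite ler_wpM2r ?nm_ge0 // ler_wpM2l //; last by rewrite mulr_natl mulr2n lerD2l.
  by rewrite mulr_ge0 // subr_ge0 ltW.
exact: inv_cvg0.
Qed.

Lemma equi_sum_linear N : (0 < N)%N -> linear (equi_sum N).
Proof.
move=> N0 c x y; rewrite /equi_sum scaler_sumr -big_split; apply: eq_bigr => j _ /=.
by rewrite F_lin ?grid_in // 1?ltnW // scalerDr !scalerA mulrC.
Qed.

Lemma equi_sum_bound N : (0 < N)%N -> op_bound (equi_sum N) ((b - a) * M).
Proof.
move=> N0 x; apply: le_trans (nm_sum _ _ _) _.
apply: le_trans (ler_sum _ (_ : forall j : 'I_N, true -> _ <= (b - a) / N%:R * (M * nm x))) _.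
  have h0 : 0 < (b - a) / N%:R by rewrite divr_gt0 ?subr_gt0 ?ltr0n.
  move=> j _; rewrite nmZ nmR (gtr0_norm h0) (ler_pM2l h0).
  by rewrite F_bound // grid_in // ltnW.
rewrite sumr_const card_ord -mulr_natl le_eqVlt; apply/orP; left; apply/eqP.
by field; rewrite pnatr_eq0 -lt0n.
Qed.

Lemma tagged_points d s tag : tagged_partition a b d s tag ->
  [/\ nth a (a :: s) 0 = a, nth a (a :: s) (size s) = b &
   forall i, (i < size s)%N -> [/\ nth a (a :: s) i <= tag i,
     tag i <= nth a (a :: s) i.+1 & nth a (a :: s) i.+1 - nth a (a :: s) i <= d]].
Proof.
move=> [[hp /eqP hl] ht]; split => //; first by rewrite -hl (last_nth a).
by move=> i /ht[h1 h2 h3]; split => //; exact: ltW.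
Qed.

Lemma riemann_sumE s tag x : riemann_sum F a s tag x =
  \sum_(i < size s) (nth a (a :: s) i.+1 - nth a (a :: s) i)%:C *: F (tag i) x.
Proof. by rewrite /riemann_sum fct_sumE. Qed.

Lemma tag_in d s tag i : tagged_partition a b d s tag -> (i < size s)%N ->
  a <= tag i <= b.
Proof.
move=> /tagged_points[p0 pm hp] im.
have sp j : (j < size s)%N -> nth a (a :: s) j <= nth a (a :: s) j.+1.
  by case/hp => h1 h2 _; exact: le_trans h2.
have bp := @steps_le _ (nth a (a :: s)) (size s) sp; rewrite p0 pm in bp.
have [h1 h2 _] := hp _ im.
have /andP[u1 u2] := bp _ (ltnW im); have /andP[u3 u4] := bp _ im.
by rewrite (le_trans u1) // (le_trans h2).
Qed.

Lemma riemann_sum_linear d s tag : tagged_partition a b d s tag ->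
  linear (riemann_sum F a s tag).
Proof.
move=> hs c x y; rewrite !riemann_sumE scaler_sumr -big_split; apply: eq_bigr => j _ /=.
by rewrite F_lin ?(tag_in hs) // scalerDr !scalerA mulrC.
Qed.

Lemma equi_tagged N d : (0 < N)%N -> (b - a) / N%:R < d ->
  let s := [seq grid N j.+1 | j <- iota 0 N] in
  tagged_partition a b d s (grid N) /\
  forall x, riemann_sum F a s (grid N) x = equi_sum N x.
Proof.
move=> N0 Nd s; have ss : size s = N by rewrite size_map size_iota.
have nthE i : (i <= N)%N -> nth a (a :: s) i = grid N i.
  case: i => [|i] iN; first by rewrite grid0.
  by rewrite /= (nth_map 0%N) ?size_iota // nth_iota // add0n.
split; last first.
  move=> x; rewrite riemann_sumE ss equi_sumE //; apply: eq_bigr => i _.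
  by rewrite !nthE // ltnW.
split; last first.
  by move=> i; rewrite ss => iN; rewrite !nthE // 1?ltnW // lexx gridS // ltW // grid_lt.
split; last by rewrite (last_nth a) ss nthE // gridN.
apply/(pathP a) => i; rewrite ss => iN.
by have := nthE _ iN; have := nthE _ (ltnW iN) => /= -> ->; exact: grid_lt.
Qed.

(** [op_integral] is chosen by [xget]; this pins down the values of whatever operator it returns. *)
Lemma is_op_integral_tends P : is_op_integral F a b P ->
  forall x, tends (fun n => equi_sum n.+1 x) (P x).
Proof.
move=> [/bounded_opP[PL _] hP] x; rewrite /tends.
apply/cvgrPdist_lt => e e0.
have n0 : 0 < nm x + 1 by rewrite ltr_wpDl // nm_ge0.
have [d d0 hd] := hP (e / (nm x + 1)) (divr_gt0 e0 n0).
have /cvgrPdist_lt/(_ d d0) := inv_cvg0 (b - a).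
have ba0 : 0 <= b - a by rewrite subr_ge0 ltW.
apply: filterS => n; rewrite sub0r normrN ger0_norm ?divr_ge0 // => nd.
rewrite sub0r normrN ger0_norm ?nm_ge0 //.
have [tp tE] := equi_tagged (ltn0Sn n) nd.
have SL : linear (riemann_sum F a [seq grid n.+1 j.+1 | j <- iota 0 n.+1] (grid n.+1) - P).
  move=> c u v; rewrite !fctE.
  by rewrite (riemann_sum_linear tp) PL scalerBr opprD addrACA.
have := opnorm_op_bound SL (ltW (hd _ _ tp)) x.
rewrite !fctE tE => h; apply: le_lt_trans h _.
by rewrite mulrAC ltr_pdivrMr // ltr_pM2l // ltrDl.
Qed.

Lemma op_integralP :
  [/\ linear (op_integral F a b), op_bound (op_integral F a b) ((b - a) * M)
    & forall x, tends (fun n => equi_sum n.+1 x) (op_integral F a b x)].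
Proof.
suff [P hP] : exists P, is_op_integral F a b P.
  have h : is_op_integral F a b (op_integral F a b) by exact: (xgetPex 0 (ex_intro _ P hP)).
  have ht := is_op_integral_tends h; split => //; first by case: h => /bounded_opP[].
  move=> x; apply: tends_nm_le (ht x) (cvg_cst _) _.
  by near=> n; exact: equi_sum_bound.
(* The candidate is the pointwise limit of the equidistant sums. The comparison with an arbitrary
   tagged sum has an error proportional to [nm x], hence holds in operator norm. *)
have [P hP] := choice equi_sum_cvg.
have PL : linear P.
  move=> c x y; apply: tends_unique (hP _) _.
  under eq_fun do rewrite equi_sum_linear //.
  by apply: tendsD => //; apply: tendsZ => //; exact: tends_cst.
exists P; split.
  apply/bounded_opP; split => //; exists ((b - a) * M).
    by rewrite mulr_ge0 // subr_ge0 ltW.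
  move=> x; apply: tends_nm_le (hP x) (cvg_cst _) _.
  by near=> n; exact: equi_sum_bound.
move=> e e0; pose d := e / (2 * ((b - a) * K + 1)).
have h0 : 0 <= (b - a) * K by rewrite mulr_ge0 // subr_ge0 ltW.
have d0 : 0 < d by rewrite divr_gt0 // mulr_gt0 // ltr_wpDl.
exists d => // s tag hs; have [p0 pm hp] := tagged_points hs.
apply: (@le_lt_trans _ _ ((b - a) * K * d)%:E); last first.
  rewrite lte_fin /d mulrA ltr_pdivrMr ?mulr_gt0 ?ltr_wpDl // mulrC.
  by rewrite ltr_pM2l //; lra.
apply: op_bound_opnorm; first by rewrite mulr_ge0 // ltW.
move=> x; rewrite !fctE riemann_sumE.
set S := \sum_(i < _) _.
apply: (@tends_nm_le _ _ (fun n => S - equi_sum n.+1 x) _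
   (fun n => (b - a) * K * (d + (b - a) / n.+1%:R) * nm x)).
- by apply: tendsD; [exact: tends_cst|exact: tendsN].
- apply: cvgM; last exact: cvg_cst.
  apply: cvgM; first exact: cvg_cst.
  rewrite -[X in _ --> X](addr0 d); apply: cvgD; [exact: cvg_cst|exact: inv_cvg0].
- by near=> n; apply: equi_sum_compare => //; exact: ltW.
Unshelve. all: by end_near. Qed.

End OperatorIntegral.

(** * Contour integrals as limits of means over roots of unity *)

Section CircleIntegral.
Context {R : realType}.
Local Notation C := R[i].
Variables (X : normedModType C) (Y : completeNormedModType C).

(** The N-point sum of the normalized contour integral: the cell length 2 pi / N, the factor i w
    from dz and the prefactor -1 / (2 pi i) combine to -w / N. *)
Definition cmean (f : C -> X -> Y) (xi : C) (r : R) (N : nat) (x : X) : Y :=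
  - (N%:R^-1 *: \sum_(j < N) root_pt N r j *: f (xi + root_pt N r j) x).

(** [spectral_proj] and [spectral_semigroup] are instances up to conversion, as are the moments used
    below. *)
Definition contour (f : C -> X -> Y) (xi : C) (r : R) : X -> Y :=
  (- (2 * 'i%C * pi%:C)^-1) *: circle_integral f xi r.

Definition circle_regular (f : C -> X -> Y) (xi : C) (r M K : R) : Prop :=
  forall t, 0 <= t <= 2 * pi ->
  [/\ linear (f (xi + circle_point r t)), op_bound (f (xi + circle_point r t)) M &
   forall s x, 0 <= s <= 2 * pi ->
     nm (f (xi + circle_point r s) x - f (xi + circle_point r t) x) <= K * `|s - t| * nm x].

Lemma contourP f xi r M K : 0 < r -> 0 <= M -> 0 <= K -> circle_regular f xi r M K ->
  [/\ linear (contour f xi r), op_bound (contour f xi r) (r * M)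
    & forall x, tends (fun n => cmean f xi r n.+1 x) (contour f xi r x)].
Proof.
move=> r0 M0 K0 hf; have p0 : 0 < 2 * pi :> R by rewrite mulr_gt0 // pi_gt0.
pose F t := ('i%C * circle_point r t) *: f (xi + circle_point r t).
have FE t x : F t x = ('i%C * circle_point r t) *: f (xi + circle_point r t) x by [].
have nw t : nm ('i%C * circle_point r t) = r.
  by rewrite nmM nmi mul1r nm_circle_point gtr0_norm.
pose L := r * expR (2 * pi).
have L0 : 0 <= L by rewrite mulr_ge0 ?expR_ge0 // ltW.
have [|||||] := @op_integralP _ X Y F 0 (2 * pi) (L * M + r * K) (r * M) p0.
- by rewrite addr_ge0 ?mulr_ge0 // ltW.
- by rewrite mulr_ge0 // ltW.
- move=> t /hf[hl _ _] c x y; rewrite !FE hl scalerDr !scalerA; congr (_ *: _ + _).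
  by rewrite mulrC.
- move=> t /hf[_ hb _] x; rewrite FE nmZ nw -mulrA ler_pM2l //; exact: hb.
- move=> s t x hs ht; rewrite !FE.
  have [_ hb hl] := hf _ ht.
  set u := 'i%C * circle_point r s; set v := 'i%C * circle_point r t.
  set g := f _ x; set h := f _ x.
  have -> : u *: g - v *: h = u *: (g - h) + (u - v) *: h.
    by rewrite scalerBr scalerBl addrA subrK.
  apply: le_trans (nmD _ _) _; rewrite !nmZ nw.
  have uv : nm (u - v) <= L * `|s - t|.
    rewrite -mulrBr nmM nmi mul1r; apply: le_trans (circle_point_lip _ hs ht) _.
    by rewrite gtr0_norm.
  have h1 : r * nm (g - h) <= r * (K * `|s - t| * nm x).
    by rewrite ler_pM2l //; exact: hl.
  have h2 : nm (u - v) * nm h <= (L * `|s - t|) * (M * nm x).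
    by apply: ler_pM; rewrite ?nm_ge0 //; exact: hb.
  apply: le_trans (lerD h1 h2) _; rewrite le_eqVlt; apply/orP; left; apply/eqP; ring.
rewrite -[op_integral _ _ _]/(circle_integral f xi r) => IL Ib It.
pose c : C := - (2 * 'i%C * pi%:C)^-1.
have nc : nm c = (2 * pi)^-1.
  rewrite nmN nmV !nmM nmi mulr1 nmR (gtr0_norm (pi_gt0 R)).
  by have -> : nm (2 : C) = 2 by exact: (@nm_nat R 2).
have cE x : contour f xi r x = c *: circle_integral f xi r x by [].
split.
- by move=> k x y; rewrite !cE IL scalerDr !scalerA mulrC.
- move=> x; rewrite cE nmZ nc; rewrite mulrC ler_pdivrMr //.
  by apply: le_trans (Ib x) _; rewrite subr0 le_eqVlt; apply/orP; left; apply/eqP; ring.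
move=> x; rewrite cE.
have : tends (fun n => c *: equi_sum F 0 (2 * pi) n.+1 x) (c *: circle_integral f xi r x).
  by apply: tendsZ => //; exact: tends_cst.
apply: tends_near; near=> n; rewrite /equi_sum /cmean -scalerN -sumrN !scaler_sumr.
apply: eq_bigr => j _; rewrite FE subr0 /grid add0r subr0 -/(root_pt n.+1 r j).
rewrite -scaleNr !scalerA; congr (_ *: _).
have p1 : (pi%:C : C) != 0 by rewrite -(rmorph0 (@real_complex R)) (inj_eq (@complexI R)) gt_eqF ?pi_gt0.
have i1 : 'i%C != 0 :> C by rewrite eq_complex /= oner_eq0 andbF.
have n1 : n.+1%:R != 0 :> C by rewrite pnatr_eq0.
rewrite /c rmorphM fmorphV rmorphM !rmorph_nat /=.
move: (pi%:C) (n.+1%:R : C) p1 n1 => P m P0 m0.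
by field; rewrite P0 i1 m0.
Unshelve. all: by end_near. Qed.

End CircleIntegral.

(** * Resolvent means on circles *)

Section Projector.
Context {R : realType}.
Local Notation C := R[i].
Variables (X : completeNormedModType C) (T : unbounded_op X) (xi : C).
Implicit Types (r s t : R) (x : X).

Definition circle_ok r : Prop :=
  forall t, 0 <= t <= 2 * pi -> ~ spectrum T (xi + circle_point r t).

Lemma root_angle N (j : 'I_N) : 0 <= j%:R * (2 * (pi : R)) / N%:R <= 2 * (pi : R).
Proof.
have N0 : (0 < N)%N by apply: leq_ltn_trans (ltn_ord j).
have p0 : 0 < 2 * pi :> R by rewrite mulr_gt0 // pi_gt0.
have := @grid_in _ 0 (2 * pi) p0 N j N0 (ltnW (ltn_ord j)).
by rewrite /grid subr0 add0r.
Qed.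

Lemma nm_root_pt N r j : nm (root_pt N r j : C) = `|r|.
Proof. exact: nm_circle_point. Qed.

Lemma nm_cmean_le (f : C -> X -> X) r N x b : (0 < N)%N -> 0 < r ->
  (forall t, 0 <= t <= 2 * pi -> nm (f (xi + circle_point r t) x) <= b) ->
  nm (cmean f xi r N x) <= r * b.
Proof.
move=> N0 r0 hb; rewrite /cmean nmN nmZ nmV nm_nat mulrC ler_pdivrMr ?ltr0n //.
apply: le_trans (nm_sum _ _ _) _.
apply: le_trans (ler_sum _ (_ : forall j : 'I_N, true -> _ <= r * b)) _.
  move=> j _; rewrite nmZ nm_root_pt (gtr0_norm r0) ler_pM2l //.
  exact/hb/root_angle.
by rewrite sumr_const card_ord mulr_natr.
Qed.

Lemma cmean_linear (f : C -> X -> X) r N :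
  (forall t, 0 <= t <= 2 * pi -> linear (f (xi + circle_point r t))) ->
  linear (cmean f xi r N).
Proof.
move=> hf c x y; rewrite /cmean scalerN -opprD !scalerA (mulrC c) -scalerA -scalerDr.
congr (- (_ *: _)); rewrite scaler_sumr -big_split; apply: eq_bigr => j _ /=.
by rewrite hf ?root_angle // scalerDr !scalerA mulrC.
Qed.

(** Boundedness on the circle is compactness; the resolvent identity then turns a bound M and the
    Lipschitz constant L of the circle into the Lipschitz constant L M^2. *)
Lemma resolvent_circle r : 0 < r -> circle_ok r ->
  exists M K, [/\ 0 <= M, 0 <= K & circle_regular (resolvent T) xi r M K].
Proof.
move=> r0 hr; have p0 : 0 < 2 * pi :> R by rewrite mulr_gt0 // pi_gt0.
pose L := `|r| * expR (2 * pi).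
have L0 : 0 <= L by rewrite mulr_ge0 ?expR_ge0.
have lip s t : 0 <= s <= 2 * pi -> 0 <= t <= 2 * pi ->
    nm ((xi + circle_point r s) - (xi + circle_point r t)) <= L * `|s - t|.
  by move=> hs ht; rewrite opprD addrACA subrr add0r; exact: circle_point_lip.
have [M M0 hM] := resolvent_path_bounded (ltW p0) L0 lip hr.
exists M, (L * M * M); split => //; first by rewrite !mulr_ge0.
move=> t ht; split; [exact/resolvent_linear/hr|exact: hM|move=> s x hs].
rewrite resolvent_identity ?nmZ; [|exact: hr..].
have h1 := lip _ _ hs ht.
have h2 := le_trans (hM _ hs _) (ler_wpM2l M0 (hM _ ht x)).
apply: le_trans (ler_pM (nm_ge0 _) (nm_ge0 _) h1 h2) _.
by rewrite le_eqVlt; apply/orP; left; apply/eqP; ring.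
Qed.

Definition circle_scalar (phi : C -> C) r m k : Prop :=
  forall t, 0 <= t <= 2 * pi -> nm (phi (xi + circle_point r t)) <= m /\
  forall s, 0 <= s <= 2 * pi ->
    nm (phi (xi + circle_point r s) - phi (xi + circle_point r t)) <= k * `|s - t|.

Lemma circle_regularZ phi (f : C -> X -> X) r m k M K : 0 <= m -> 0 <= k -> 0 <= M ->
  0 <= K -> circle_scalar phi r m k -> circle_regular f xi r M K ->
  circle_regular (fun z => phi z *: f z) xi r (m * M) (m * K + k * M).
Proof.
move=> m0 k0 M0 K0 hp hf t ht; have [pm pk] := hp _ ht; have [fl fb fk] := hf _ ht.
split=> [c x y|x|s x hs]; rewrite !fctE.
- by rewrite fl scalerDr !scalerA mulrC.
- by rewrite nmZ -mulrA; apply: ler_pM; rewrite ?nm_ge0 //; exact: fb.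
have [qm _] := hp _ hs.
set u := phi _; set v := phi _; set g := f _ x; set h := f _ x.
have -> : u *: g - v *: h = u *: (g - h) + (u - v) *: h.
  by rewrite scalerBr scalerBl addrA subrK.
apply: le_trans (nmD _ _) _; rewrite !nmZ.
apply: le_trans (lerD (ler_pM (nm_ge0 _) (nm_ge0 _) qm (fk s x hs))
  (ler_pM (nm_ge0 _) (nm_ge0 _) (pk s hs) (fb x))) _.
by rewrite le_eqVlt; apply/orP; left; apply/eqP; ring.
Qed.

Lemma circle_scalarX r j : 0 < r ->
  exists m k, [/\ 0 <= m, 0 <= k & circle_scalar (fun z => z ^+ j) r m k].
Proof.
move=> r0; elim: j => [|j [m [k [m0 k0 hmk]]]].
  exists 1, 0; split=> // t ht; rewrite expr0 nm1; split=> // s hs.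
  by rewrite subrr nm0 mul0r.
pose L := `|r| * expR (2 * pi).
have L0 : 0 <= L by rewrite mulr_ge0 ?expR_ge0.
have lip s t : 0 <= s <= 2 * pi -> 0 <= t <= 2 * pi ->
    nm ((xi + circle_point r s) - (xi + circle_point r t)) <= L * `|s - t|.
  by move=> hs ht; rewrite opprD addrACA subrr add0r; exact: circle_point_lip.
pose b := nm xi + r.
have b0 : 0 <= b by rewrite addr_ge0 ?nm_ge0 // ltW.
have zb t : nm (xi + circle_point r t) <= b.
  by apply: le_trans (nmD _ _) _; rewrite nm_circle_point gtr0_norm.
exists (b * m), (b * k + L * m); split; [by rewrite mulr_ge0|by rewrite addr_ge0 ?mulr_ge0|].
move=> t ht; have [pm pk] := hmk _ ht; split.
  by rewrite exprS nmM; apply: ler_pM; rewrite ?nm_ge0.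
move=> s hs; set z := xi + circle_point r s; set w := xi + circle_point r t.
have -> : z ^+ j.+1 - w ^+ j.+1 = z * (z ^+ j - w ^+ j) + (z - w) * w ^+ j.
  by rewrite !exprS; ring.
apply: le_trans (nmD _ _) _; rewrite !nmM.
apply: le_trans (lerD (ler_pM (nm_ge0 _) (nm_ge0 _) (zb s) (pk s hs))
  (ler_pM (nm_ge0 _) (nm_ge0 _) (lip _ _ hs ht) pm)) _.
by rewrite le_eqVlt; apply/orP; left; apply/eqP; ring.
Qed.

Lemma circle_scalar_exp r t : 0 < r ->
  exists m k, [/\ 0 <= m, 0 <= k & circle_scalar (fun z => expC (z * t%:C)) r m k].
Proof.
move=> r0; pose L := `|r| * expR (2 * pi).
have L0 : 0 <= L by rewrite mulr_ge0 ?expR_ge0.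
pose b := (nm xi + r) * `|t|.
have b0 : 0 <= b by rewrite mulr_ge0 // addr_ge0 ?nm_ge0 // ltW.
have zb u : nm ((xi + circle_point r u) * t%:C) <= b.
  rewrite nmM nmR ler_wpM2r //.
  by apply: le_trans (nmD _ _) _; rewrite nm_circle_point gtr0_norm.
exists (expR b * b + 1), (expR b * L * `|t|); split.
- by apply: addr_ge0 => //; apply: mulr_ge0 => //; exact: expR_ge0.
- by apply: mulr_ge0 => //; apply: mulr_ge0 => //; exact: expR_ge0.
move=> u hu; split.
  have := @expC_lip _ ((xi + circle_point r u) * t%:C) 0 b (zb u).
  rewrite nm0 subr0 expC0 => /(_ b0) h.
  rewrite -[X in nm X <= _](subrK 1); apply: le_trans (nmD _ _) _; rewrite nm1 lerD2r.
  by apply: le_trans h _; rewrite ler_wpM2l ?expR_ge0.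
move=> s hs; apply: le_trans (expC_lip (zb s) (zb u)) _.
rewrite -mulrBl opprD addrACA subrr add0r nmM nmR.
have h := circle_point_lip r hs hu.
apply: le_trans (ler_wpM2l (expR_ge0 b) (ler_wpM2r (normr_ge0 t) h)) _.
by rewrite le_eqVlt; apply/orP; left; apply/eqP; rewrite /L; ring.
Qed.

Lemma resolvent_contour phi r m k : 0 < r -> circle_ok r -> 0 <= m -> 0 <= k ->
  circle_scalar phi r m k ->
  [/\ linear (contour (fun z => phi z *: resolvent T z) xi r),
      exists2 c, 0 <= c & op_bound (contour (fun z => phi z *: resolvent T z) xi r) c
    & forall x, tends (fun n => cmean (fun z => phi z *: resolvent T z) xi r n.+1 x)
        (contour (fun z => phi z *: resolvent T z) xi r x)].
Proof.
move=> r0 hr m0 k0 hp; have [M [K [M0 K0 hf]]] := resolvent_circle r0 hr.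
have [||h1 h2 h3] := contourP r0 _ _ (circle_regularZ m0 k0 M0 K0 hp hf).
- by rewrite mulr_ge0.
- by rewrite addr_ge0 ?mulr_ge0.
by split=> //; exists (r * (m * M)) => //; rewrite !mulr_ge0 // ltW.
Qed.

Lemma spectral_projP r : 0 < r -> circle_ok r ->
  [/\ linear (spectral_proj T xi r),
      exists2 c, 0 <= c & op_bound (spectral_proj T xi r) c
    & forall x, tends (fun n => cmean (resolvent T) xi r n.+1 x) (spectral_proj T xi r x)].
Proof.
move=> r0 hr; have [M [K [M0 K0 hf]]] := resolvent_circle r0 hr.
have [h1 h2 h3] := contourP r0 M0 K0 hf.
by split=> //; exists (r * M) => //; rewrite mulr_ge0 // ltW.
Qed.

Lemma spectral_semigroupE r t :
  spectral_semigroup T xi r t = contour (fun z => expC (z * t%:C) *: resolvent T z) xi r.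
Proof. by []. Qed.

(** The resolvent identity splits R(w_j) R(v_k) into a difference, leaving a double sum of kernels 1
    / (w_j - v_k). These have no zero denominator because the N-th powers r^N and r'^N differ. *)
Lemma cmean_product r r' N x : (0 < N)%N -> 0 < r -> 0 < r' -> r != r' ->
  circle_ok r -> circle_ok r' ->
  cmean (resolvent T) xi r N (cmean (resolvent T) xi r' N x) =
  (r' ^+ N / (r' ^+ N - r ^+ N))%:C *: cmean (resolvent T) xi r N x -
  (r ^+ N / (r' ^+ N - r ^+ N))%:C *: cmean (resolvent T) xi r' N x.
Proof.
move=> N0 r0 r'0 rr' hr hr'.
have rrN : r ^+ N != r' ^+ N by rewrite eqrXn2 // ltW.
pose w j : C := root_pt N r j; pose v j : C := root_pt N r' j.
pose Rs z := resolvent T (xi + z).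
have okw (j : 'I_N) : ~ spectrum T (xi + w j) by exact/hr/root_angle.
have okv (j : 'I_N) : ~ spectrum T (xi + v j) by exact/hr'/root_angle.
have wv (j k : 'I_N) : w j - v k != 0.
  apply: contra_neq rrN => /eqP; rewrite subr_eq0 => /eqP /(congr1 (fun z => z ^+ N)).
  by rewrite !root_ptX // => /complexI.
have NC : (N%:R : C) != 0 by rewrite pnatr_eq0 -lt0n.
pose a : C := (r ^+ N)%:C; pose b : C := (r' ^+ N)%:C.
have ab : b - a != 0.
  by rewrite subr_eq0 (inj_eq (@complexI R)) eq_sym.
pose Sw := \sum_(j < N) w j *: Rs (w j) x.
pose Sv := \sum_(k < N) v k *: Rs (v k) x.
have E (j : 'I_N) : Rs (w j) Sv =
    \sum_(k < N) (v k / (w j - v k)) *: (Rs (w j) x - Rs (v k) x).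
  rewrite /Rs lin_sum; last exact/resolvent_linear/okw.
  apply: eq_bigr => k _; rewrite linZ; last exact/resolvent_linear/okw.
  rewrite resolvent_identity ?scalerA; [|exact: okw|exact: okv].
  by rewrite opprD addrACA subrr add0r mulfVK.
(* The kernel sum depends on w_j only through its N-th power, hence not on j; likewise [EB] does not
   depend on k. Both therefore factor out of the remaining single sums. *)
have EA (j : 'I_N) : \sum_(k < N) v k / (w j - v k) = - (N%:R * b / (b - a)).
  have := @sum_root_pt_cauchy _ N r' (w j) N0.
  rewrite root_ptX // => <-; last by rewrite (inj_eq (@complexI R)).
  by rewrite -sumrN; apply: eq_bigr => k _; rewrite -[w j - v k]opprB invrN mulrN.
have EB (k : 'I_N) : \sum_(j < N) w j / (w j - v k) = - (N%:R * a / (b - a)).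
  have := @sum_root_pt_cauchy _ N r (v k) N0.
  rewrite root_ptX // => ->; last by rewrite (inj_eq (@complexI R)) eq_sym.
  by rewrite -[b - a]opprB invrN mulrN opprK.
have main : \sum_(j < N) w j *: Rs (w j) Sv =
    - (N%:R * b / (b - a)) *: Sw + (N%:R * a / (b - a)) *: Sv.
  transitivity (\sum_(j < N) (w j * \sum_(k < N) v k / (w j - v k)) *: Rs (w j) x
    - \sum_(k < N) (v k * \sum_(j < N) w j / (w j - v k)) *: Rs (v k) x).
    rewrite [X in _ - X](_ : _ = \sum_(j < N) \sum_(k < N)
        (w j * (v k / (w j - v k))) *: Rs (v k) x); last first.
      rewrite exchange_big /=; apply: eq_bigr => k _.
      rewrite mulr_sumr scaler_suml; apply: eq_bigr => j _.
      by congr (_ *: _); rewrite mulrCA.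
    rewrite -sumrB; apply: eq_bigr => j _; rewrite E scaler_sumr mulr_sumr scaler_suml.
    by rewrite -sumrB; apply: eq_bigr => k _; rewrite scalerA scalerBr.
  rewrite /Sw /Sv !scaler_sumr -sumrN -!big_split; apply: eq_bigr => j _ /=.
  by rewrite EA EB !scalerA !mulrN !mulNr !scaleNr opprK !(mulrC (_ / _)).
have rC : ((r' ^+ N / (r' ^+ N - r ^+ N))%:C : C) = b / (b - a) /\
          ((r ^+ N / (r' ^+ N - r ^+ N))%:C : C) = a / (b - a).
  by rewrite /a /b -!rmorphB -!fmorphV -!rmorphM.
rewrite !rC.1 !rC.2 {rC}.
rewrite {1}/cmean [in LHS]/cmean -/Sv.
have -> : \sum_(j < N) root_pt N r j *: resolvent T (xi + root_pt N r j) (- (N%:R^-1 *: Sv))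
    = - (N%:R^-1 *: \sum_(j < N) w j *: Rs (w j) Sv).
  rewrite [X in _ = - X]scaler_sumr -sumrN; apply: eq_bigr => j _.
  rewrite -scaleNr linZ; last exact/resolvent_linear/okw.
  by rewrite -/(Rs (w j) Sv) !scalerA mulrN scaleNr mulrC.
rewrite main scalerN opprK scalerDr !scalerA /cmean -/Sw -/Sv !scalerN opprK !scalerA.
by rewrite scalerDr !scalerA -scaleNr; congr (_ *: _ + _ *: _); field; rewrite NC ab.
Qed.

End Projector.

(** * Spectral projectors *)

Section Limits.
Context {R : realType}.
Local Notation C := R[i].

Lemma tends_real (c : nat -> R) (l : R) : c @ \oo --> l ->
  tends (fun n => (c n)%:C : C) (l%:C).
Proof.
move=> cl; apply: (@tends_le _ _ _ _ (fun n => `|c n - l|)).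
  by near=> n; rewrite -rmorphB nmR.
rewrite -(@normr0 _ R) -(subrr l); apply: cvg_norm; apply: cvgB => //; exact: cvg_cst.
Unshelve. all: by end_near. Qed.

(** Pointwise convergence alone does not control S_n at a moving point; the uniform bound M does.
    This carries the product of two circle means to the product of the projectors. *)
Lemma tends_comp (X Y : normedModType C) (S : nat -> X -> Y) (P : X -> Y) M u l :
  (forall n, linear (S n)) -> (forall n, op_bound (S n) M) ->
  (forall x, tends (fun n => S n x) (P x)) -> tends u l ->
  tends (fun n => S n (u n)) (P l).
Proof.
move=> SL SM SP ul.
have h : tends (fun n => S n (u n - l)) 0.
  apply: (@tends_le _ _ _ _ (fun n => M * nm (u n - l))).
    by near=> n; rewrite subr0; exact: SM.
  by rewrite -(mulr0 M); apply: cvgM ul; exact: cvg_cst.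
have := tendsD h (SP l); rewrite add0r.
by apply: tends_near; near=> n; rewrite linB // subrK.
Unshelve. all: by end_near. Qed.

Lemma small_le0 (v d K : R) : 0 < d -> 0 <= K ->
  (forall e, 0 < e < d -> v <= K * e) -> v <= 0.
Proof.
move=> d0 K0 h; rewrite leNgt; apply/negP => v0.
have K1 : 0 < 2 * (K + 1) by rewrite mulr_gt0 // ltr_wpDl.
pose e := Num.min (d / 2) (v / (2 * (K + 1))).
have e0 : 0 < e by rewrite lt_min !divr_gt0.
have ed : e < d by apply: (@le_lt_trans _ _ (d / 2)); [rewrite ge_min lexx|lra].
have := h e; rewrite e0 ed => /(_ isT); apply/negP; rewrite -ltNge.
have : e <= v / (2 * (K + 1)) by rewrite ge_min lexx orbT.
rewrite ler_pdivlMr // => h1; nra.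
Qed.

End Limits.

Lemma nested_projectors_eq (R : realType) (X : normedModType R[i]) (P : R -> X -> X)
    (a b : R) : a <= b ->
  (forall s, a <= s <= b -> linear (P s)) ->
  (forall s x, a <= s <= b -> P s (P s x) = P s x) ->
  (forall s s' x, a <= s <= b -> a <= s' <= b -> s < s' ->
     P s (P s' x) = P s x /\ P s' (P s x) = P s x) ->
  (forall t, a <= t <= b -> exists d c, [/\ 0 < d, 0 <= c &
     forall s, a <= s <= b -> `|s - t| < d ->
       forall x, nm (P s x - P t x) <= c * `|s - t| * nm x]) ->
  forall x, P b x = P a x.
Proof.
move=> ab PL idem nest lip.
apply: (@path_ind _ (fun s => forall x, P s x = P a x) a b ab) => // t ht.
have [d [c [d0 c0 hd]]] := lip _ ht.
have c1 : 0 < 4 * (c + 1) by rewrite mulr_gt0 // ltr_wpDl.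
(* Within this distance, P s and P s' both differ from P t by at most 1/4 in norm, hence from each
   other by at most 1/2. *)
exists (Num.min d (4 * (c + 1))^-1); first by rewrite lt_min d0 invr_gt0.
suff H s s' : s < s' -> a <= s <= b -> a <= s' <= b ->
    `|s - t| < Num.min d (4 * (c + 1))^-1 -> `|s' - t| < Num.min d (4 * (c + 1))^-1 ->
    forall x, P s' x = P s x.
  move=> s s' hs hs' sd sd' Ps x; rewrite -Ps.
  case: (ltgtP s s') => [h|h|->] //; first exact: H.
  by symmetry; exact: H.
move=> ss' hs hs'; rewrite !lt_min => /andP[sd1 sd2] /andP[sd1' sd2'] x.
apply/eqP; rewrite -subr_eq0; apply/eqP/nm_le0.
(* The difference of nested projectors is a projector, here of norm < 1. *)
set y := P s' x - P s x.
have yy : P s' y - P s y = y.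
  have [h1 h2] := nest s s' x hs hs' ss'.
  by rewrite /y (linB (PL _ hs')) (linB (PL _ hs)) !idem // h1 h2 subrr subr0.
have h : nm y <= 1 / 2 * nm y.
  rewrite -{1}yy; apply: le_trans (nm_triangle (P t y) _ _) _.
  have h1 := hd _ hs' sd1' y; have h2 := hd _ hs sd1 y; rewrite nmBC in h2.
  apply: le_trans (lerD h1 h2) _; rewrite -mulrDl -mulrDr.
  rewrite ler_wpM2r ?nm_ge0 //.
  move: sd2 sd2'; rewrite -div1r !ltr_pdivlMr // => sd2 sd2'.
  by have := normr_ge0 (s - t); have := normr_ge0 (s' - t); nra.
by have := nm_ge0 y; lra.
Qed.

(* Otherwise unification between two projectors unfolds the integrals and diverges. *)
#[local] Opaque spectral_proj spectral_semigroup.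

Section SpectralProjector.
Context {R : realType}.
Local Notation C := R[i].
Variables (X : completeNormedModType C) (T : unbounded_op X) (xi : C).
Implicit Types (r s t : R) (x : X).
Local Notation ok := (circle_ok T xi).
Local Notation Pi := (spectral_proj T xi).
Local Notation S := (cmean (resolvent T) xi).

Lemma cmean_resolvent_bound r : 0 < r -> ok r ->
  exists2 M, 0 <= M & forall n, op_bound (S r n.+1) M.
Proof.
move=> r0 hr; have [M [K [M0 K0 hf]]] := resolvent_circle r0 hr.
exists (r * M) => [|n x]; first by rewrite mulr_ge0 // ltW.
rewrite -mulrA; apply: nm_cmean_le => // t ht.
by have [_ h _] := hf _ ht; exact: h.
Qed.

Lemma cmean_resolvent_linear r n : ok r -> linear (S r n).
Proof. by move=> hr; apply: cmean_linear => t ht; exact/resolvent_linear/hr. Qed.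

(** In [cmean_product] the coefficient r'^N / (r'^N - r^N) tends to 1 and r^N / (r'^N - r^N) to 0,
    because r / r' < 1. Only the mean over the smaller circle survives, in either order of the
    factors. *)
Lemma spectral_proj_mul r r' x : 0 < r -> r < r' -> ok r -> ok r' ->
  Pi r (Pi r' x) = Pi r x /\ Pi r' (Pi r x) = Pi r x.
Proof.
move=> r0 rr' hr hr'; have r'0 := lt_trans r0 rr'.
have [_ _ tr] := spectral_projP r0 hr; have [_ _ tr'] := spectral_projP r'0 hr'.
pose q := r / r'.
have q0 : 0 <= q by rewrite divr_ge0 // ltW.
have q1 : q < 1 by rewrite ltr_pdivrMr // mul1r.
have qn n : q ^+ n.+1 < 1 by rewrite exprn_ilt1.
have b0 : (fun n => r ^+ n.+1 / (r' ^+ n.+1 - r ^+ n.+1)) @ \oo --> (0 : R).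
  have -> : (fun n => r ^+ n.+1 / (r' ^+ n.+1 - r ^+ n.+1)) =
      (fun n => q ^+ n.+1 / (1 - q ^+ n.+1)).
    apply/funext => n; rewrite /q expr_div_n.
    have h1 : r' ^+ n.+1 != 0 by rewrite expf_neq0 // gt_eqF.
    have h2 : r' ^+ n.+1 - r ^+ n.+1 != 0.
      by rewrite subr_eq0 eqrXn2 ?ltW // gt_eqF.
    by field; rewrite h1 h2.
  have qc : (fun n => q ^+ n.+1) @ \oo --> (0 : R).
    by rewrite (cvg_shiftS (fun n => q ^+ n)); apply: cvg_expr; rewrite ger0_norm.
  have -> : 0 = 0 / (1 - 0) :> R by rewrite mul0r.
  apply: cvgM => //; apply: cvgV; first by rewrite subr0 oner_eq0.
  by apply: cvgB => //; exact: cvg_cst.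
have a1 : (fun n => r' ^+ n.+1 / (r' ^+ n.+1 - r ^+ n.+1)) @ \oo --> (1 : R).
  have -> : (fun n => r' ^+ n.+1 / (r' ^+ n.+1 - r ^+ n.+1)) =
      (fun n => 1 + r ^+ n.+1 / (r' ^+ n.+1 - r ^+ n.+1)).
    apply/funext => n.
    have h2 : r' ^+ n.+1 - r ^+ n.+1 != 0.
      by rewrite subr_eq0 eqrXn2 ?ltW // gt_eqF.
    by field; rewrite h2.
  by rewrite -[X in _ --> X](addr0 (1 : R)); apply: cvgD => //; exact: cvg_cst.
have lim : tends (fun n =>
    (r' ^+ n.+1 / (r' ^+ n.+1 - r ^+ n.+1))%:C *: S r n.+1 x -
    (r ^+ n.+1 / (r' ^+ n.+1 - r ^+ n.+1))%:C *: S r' n.+1 x) (Pi r x).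
  have := tendsD (tendsZ (tends_real a1) (tr x)) (tendsN (tendsZ (tends_real b0) (tr' x))).
  by rewrite scale1r scale0r subr0.
have [M M0 hM] := cmean_resolvent_bound r0 hr.
have [M' M'0 hM'] := cmean_resolvent_bound r'0 hr'.
split; apply: tends_unique lim.
  apply: tends_near (tends_comp (fun n => cmean_resolvent_linear n.+1 hr) hM tr (tr' x)).
  by near=> n; rewrite cmean_product // lt_eqF.
apply: tends_near (tends_comp (fun n => cmean_resolvent_linear n.+1 hr') hM' tr' (tr x)).
near=> n; rewrite cmean_product // ?gt_eqF // -[r ^+ _ - _]opprB invrN !mulrN !rmorphN.
by rewrite !scaleNr opprK addrC.
Unshelve. all: by end_near. Qed.

Lemma circle_point_dist r r0 t :
  nm (xi + circle_point r t - (xi + circle_point r0 t)) = `|r - r0|.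
Proof.
by rewrite opprD addrACA subrr add0r /circle_point -mulrBl -rmorphB nm_circle_point.
Qed.

(** Sample points with the same angle are |r - r0| apart, so [resolvent_open] bounds the resolvent
    by 2 M on the nearby circles; the sums are then compared term by term with the resolvent
    identity. *)
Lemma spectral_proj_lip r0 : 0 < r0 -> ok r0 -> exists d c, [/\ 0 < d, 0 <= c &
  forall r, `|r - r0| < d -> [/\ 0 < r, ok r &
    forall x, nm (Pi r x - Pi r0 x) <= c * `|r - r0| * nm x]].
Proof.
move=> r00 hr0; have [M [K [M0 K0 hf]]] := resolvent_circle r00 hr0.
have M1 : 0 < 2 * (M + 1) by rewrite mulr_gt0 // ltr_wpDl.
exists (Num.min r0 (2 * (M + 1))^-1), (2 * M + r0 * (2 * M * M)); split.
- by rewrite lt_min r00 invr_gt0.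
- by rewrite addr_ge0 ?mulr_ge0 // ltW.
move=> r; rewrite lt_min => /andP[rd1 rd2].
have rp : 0 < r by move: rd1; rewrite ltr_norml => /andP[h _]; lra.
have near_ok t : 0 <= t <= 2 * pi ->
    ~ spectrum T (xi + circle_point r t) /\ op_bound (resolvent T (xi + circle_point r t)) (2 * M).
  move=> ht; have [_ hb _] := hf _ ht.
  apply: (resolvent_open (hr0 _ ht) M0 hb); rewrite circle_point_dist.
  move: rd2; rewrite -div1r ltr_pdivlMr // => rd2.
  by have := normr_ge0 (r - r0); nra.
have hr : ok r by move=> t /near_ok[].
split=> // x.
have [_ _ tr] := spectral_projP rp hr; have [_ _ tr0] := spectral_projP r00 hr0.
apply: (@tends_nm_le _ _ (fun n => S r n.+1 x - S r0 n.+1 x) _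
  (fun=> (2 * M + r0 * (2 * M * M)) * `|r - r0| * nm x)).
- by apply: tendsD => //; exact: tendsN.
- exact: cvg_cst.
near=> n; rewrite /cmean -opprD nmN -scalerN -scalerDr -sumrN -big_split /=.
rewrite nmZ nmV nm_nat mulrC ler_pdivrMr ?ltr0n //.
apply: le_trans (nm_sum _ _ _) _.
set b := (2 * M + _) * _ * _.
apply: le_trans (ler_sum _ (_ : forall j : 'I_n.+1, true -> _ <= b)) _; last first.
  by rewrite sumr_const card_ord mulr_natr.
move=> j _; have ht := @root_angle R _ j.
rewrite /root_pt; move: (_ / _) ht => t ht.
set u := circle_point r t; set v := circle_point r0 t.
set g := resolvent T (xi + u) x; set h := resolvent T (xi + v) x.
have -> : u *: g - v *: h = (u - v) *: g + v *: (g - h).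
  by rewrite scalerBr scalerBl addrA subrK.
have [okt bt] := near_ok _ ht; have [_ hb _] := hf _ ht.
have duv : nm (u - v) = `|r - r0|.
  by rewrite -(circle_point_dist r r0 t) opprD addrACA subrr add0r.
have gh : nm (g - h) <= `|r - r0| * (2 * M * (M * nm x)).
  rewrite resolvent_identity //; last exact: hr0.
  rewrite nmZ circle_point_dist ler_wpM2l //.
  by apply: le_trans (bt _) _; rewrite ler_wpM2l ?mulr_ge0 //; exact: hb.
apply: le_trans (nmD _ _) _; rewrite !nmZ duv nm_circle_point (gtr0_norm r00).
have h1 : `|r - r0| * nm g <= `|r - r0| * (2 * M * nm x).
  by rewrite ler_wpM2l //; exact: bt.
apply: le_trans (lerD h1 (ler_wpM2l (ltW r00) gh)) _.
by rewrite /b le_eqVlt; apply/orP; left; apply/eqP; ring.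
Unshelve. all: by end_near. Qed.

(** Pi_r Pi_(r+e) = Pi_r holds exactly for small e > 0, and Pi_(r+e) x is within O(e) of Pi_r x. *)
Lemma spectral_proj_idem r x : 0 < r -> ok r -> Pi r (Pi r x) = Pi r x.
Proof.
move=> r0 hr; have [PL [c c0 Pc] _] := spectral_projP r0 hr.
have [d [k [d0 k0 hd]]] := spectral_proj_lip r0 hr.
apply/eqP; rewrite -subr_eq0; apply/eqP/nm_le0.
apply: (@small_le0 _ _ d (c * k * nm x)) => //.
  by rewrite !mulr_ge0 ?nm_ge0.
move=> e /andP[e0 ed].
have eE : `|(r + e) - r| = e by rewrite addrC addKr gtr0_norm.
have [|re0 hre hP] := hd (r + e); first by rewrite eE.
have rre : r < r + e by rewrite ltrDl.
rewrite -[X in _ - X](spectral_proj_mul x r0 rre hr hre).1 -linB //.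
apply: le_trans (Pc _) _; rewrite nmBC -!mulrA ler_wpM2l //.
by apply: le_trans (hP x) _; rewrite eE -mulrA (mulrC e).
Qed.

Lemma spectral_proj_radius r r' x : 0 < r -> r <= r' ->
  (forall s, r <= s <= r' -> ok s) -> Pi r' x = Pi r x.
Proof.
move=> r0 rr' hok.
have pos s : r <= s <= r' -> 0 < s by case/andP => h _; exact: lt_le_trans h.
apply: (@nested_projectors_eq _ _ Pi r r' rr') => [s hs|s hs y|s s' y hs hs' ss'|t ht].
- by have [] := spectral_projP (pos _ hs) (hok _ hs).
- by apply: spectral_proj_idem; [exact: pos|exact: hok].
- by apply: spectral_proj_mul => //; [exact: pos|exact: hok|exact: hok].
have [d [c [d0 c0 hd]]] := spectral_proj_lip (pos _ ht) (hok _ ht).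
by exists d, c; split=> // s _ /hd[].
Qed.

(** The polynomial w^l (xi + w)^j has no constant term and degree below N, so each of its monomials
    sums to zero over the sample points. *)
Lemma sum_root_pt_mono N r l j : (0 < l)%N -> (l + j < N)%N ->
  \sum_(k < N) root_pt N r k ^+ l * (xi + root_pt N r k) ^+ j = 0.
Proof.
elim: j l => [|j IH] l l0 lj.
  under eq_bigr do rewrite expr0 mulr1.
  by rewrite sum_root_ptX // l0 -(addn0 l).
have h1 : (l + j < N)%N by apply: leq_ltn_trans lj; rewrite addnS.
have h2 : (l.+1 + j < N)%N by rewrite addSnnS.
rewrite (eq_bigr (fun k : 'I_N => xi * (root_pt N r k ^+ l * (xi + root_pt N r k) ^+ j)
    + root_pt N r k ^+ l.+1 * (xi + root_pt N r k) ^+ j)); last first.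
  by move=> k _; rewrite !exprS; ring.
by rewrite big_split /= -mulr_sumr IH // IH // mulr0 addr0.
Qed.

Lemma closed_op_tends u l m : closed_densely_defined T -> (forall n, dom T (u n)) ->
  tends u l -> tends (fun n => T (u n)) m -> dom T l /\ T l = m.
Proof.
move=> [cT _] hu /tends_cvg ul /tends_cvg um.
suff [h1 h2] : [set p : X * X | dom T p.1 /\ p.2 = T p.1] (l, m) by [].
have hn : \forall n \near \oo, [set p : X * X | dom T p.1 /\ p.2 = T p.1] (u n, T (u n)).
  by near=> n; split => /=.
have hc : (fun n => (u n, T (u n))) @ \oo --> ((l, m) : X * X) by exact: cvg_pair.
exact: (closed_cvg _ cT hn _ hc).
Unshelve. all: by end_near. Qed.

Definition moment r j : X -> X := contour (fun z => z ^+ j *: resolvent T z) xi r.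

Lemma momentP r j x : 0 < r -> ok r ->
  tends (fun n => cmean (fun z => z ^+ j *: resolvent T z) xi r n.+1 x) (moment r j x).
Proof.
move=> r0 hr; have [m [k [m0 k0 hmk]]] := @circle_scalarX R xi r j r0.
by have [_ _ h] := resolvent_contour r0 hr m0 k0 hmk; exact: h.
Qed.

Lemma moment0 r x : 0 < r -> ok r -> moment r 0 x = Pi r x.
Proof.
move=> r0 hr; apply: tends_unique (momentP 0 x r0 hr) _.
have [_ _ tr] := spectral_projP r0 hr.
apply: tends_near (tr x); near=> n; rewrite /cmean; congr (- (_ *: _)).
by apply: eq_bigr => j _; rewrite fctE expr0 scale1r.
Unshelve. all: by end_near. Qed.

(** T R(z) = 1 + z R(z). The contribution of 1 is a sum of w (xi + w)^j, which vanishes exactly once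
    N > j + 1, so T maps the j-th means to the next ones and closedness passes this to the limit. *)
Lemma op_moment r j x : closed_densely_defined T -> 0 < r -> ok r ->
  dom T (moment r j x) /\ T (moment r j x) = moment r j.+1 x.
Proof.
move=> cT r0 hr.
have okj n (k : 'I_n) : ~ spectrum T (xi + root_pt n r k) by exact/hr/root_angle.
have hdom n (k : 'I_n) : dom T (root_pt n r k *:
    ((fun z => z ^+ j *: resolvent T z) (xi + root_pt n r k) x)).
  by rewrite fctE; do 2 apply: domZ; exact: resolvent_dom.
apply: closed_op_tends cT _ (momentP j x r0 hr) _.
  move=> n; rewrite /cmean -scaleNr; apply: domZ; exact: dom_sum.
apply: tends_near (momentP j.+1 x r0 hr); exists j.+2 => // n /= jn.
rewrite /cmean -[in RHS]scaleNr op_linZ ?op_lin_sum //; last exact: dom_sum.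
rewrite scaleNr; congr (- (_ *: _)).
have := sum_root_pt_mono r (isT : (0 < 1)%N) (_ : (1 + j < n.+1)%N).
rewrite add1n ltnS => /(_ (ltnW jn)) h.
have E (k : 'I_n.+1) : T (root_pt n.+1 r k *:
      (fun z => z ^+ j *: resolvent T z) (xi + root_pt n.+1 r k) x) =
    (root_pt n.+1 r k ^+ 1 * (xi + root_pt n.+1 r k) ^+ j) *: x +
    root_pt n.+1 r k *: (fun z => z ^+ j.+1 *: resolvent T z) (xi + root_pt n.+1 r k) x.
  rewrite !fctE op_linZ; last by apply: domZ; exact: resolvent_dom.
  rewrite op_linZ; last exact: resolvent_dom.
  rewrite op_resolvent // expr1 !scalerDr !scalerA; congr (_ + _ *: _).
  by rewrite exprSr mulrA.
by rewrite [RHS](eq_bigr _ (fun k _ => E k)) big_split /= -scaler_suml h scale0r add0r.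
Qed.

Lemma iter_op_moment r j x : closed_densely_defined T -> 0 < r -> ok r ->
  iter j T (Pi r x) = moment r j x.
Proof.
move=> cT r0 hr; elim: j => [|j IH] /=; first by rewrite moment0.
by rewrite IH; have [] := op_moment j x cT r0 hr.
Qed.

(** Partial sums of exp(t T) Pi x are contours with weight the Taylor polynomial of e^(zt). On the
    circle |z t| <= [b], so replacing e^(zt) by that polynomial costs at most r times the real
    remainder at [b], uniformly in the number of sample points. *)
Lemma spectral_semigroup_exp r t x : closed_densely_defined T -> 0 < r -> ok r ->
  spectral_semigroup T xi r t x = exp_op T t (Pi r x).
Proof.
move=> cT r0 hr; have [M [K [M0 K0 hf]]] := resolvent_circle r0 hr.
have [m [k [m0 k0 hmk]]] := @circle_scalar_exp R xi r t r0.
have [_ _ /(_ x) tQ] := resolvent_contour r0 hr m0 k0 hmk.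
rewrite -spectral_semigroupE in tQ.
pose b := (nm xi + r) * `|t|.
have zb u : nm ((xi + circle_point r u) * t%:C) <= b.
  rewrite nmM nmR ler_wpM2r //.
  by apply: le_trans (nmD _ _) _; rewrite nm_circle_point gtr0_norm.
suff lim : tends (series (fun j => (t ^+ j / j`!%:R)%:C *: iter j T (Pi r x)))
    (spectral_semigroup T xi r t x).
  rewrite /exp_op; symmetry; apply: cvg_lim; first exact: norm_hausdorff.
  by apply/tends_cvg; exact: lim.
apply: (@tends_le _ _ _ _ (fun J => r * ((expR b - exp_sum J b) * (M * nm x)))); last first.
  rewrite -(mulr0 r); apply: cvgM; first exact: cvg_cst.
  rewrite -(mul0r (M * nm x)); apply: cvgM; last exact: cvg_cst.
  rewrite -(subrr (expR b)); apply: cvgB; [exact: cvg_cst|exact: exp_sum_cvg].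
near=> J; rewrite nmBC.
pose cs n := \sum_(0 <= j < J) (t ^+ j / j`!%:R)%:C *:
  cmean (fun z => z ^+ j *: resolvent T z) xi r n.+1 x.
have tcs : tends cs (series (fun j => (t ^+ j / j`!%:R)%:C *: iter j T (Pi r x)) J).
  rewrite /cs /series /=; elim: (J) => [|J' IH].
    by rewrite big_nil; under eq_fun do rewrite big_nil; exact: tends_cst.
  rewrite big_nat_recr //=; under eq_fun do rewrite big_nat_recr //=.
  apply: tendsD; first exact: IH.
  apply: tendsZ; first exact: tends_cst.
  rewrite (iter_op_moment _ _ cT r0 hr); exact: (momentP J' x r0 hr).
have tD := tendsD tQ (tendsN tcs).
apply: (tends_nm_le tD); [exact: cvg_cst|near=> n].
have csE : cs n = cmean (fun z => exp_sum J (z * t%:C) *: resolvent T z) xi r n.+1 x.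
  rewrite /cs /cmean; under eq_bigr do rewrite scalerN scalerA mulrC -scalerA scaler_sumr.
  rewrite sumrN -scaler_sumr exchange_big /=; congr (- (_ *: _)).
  apply: eq_bigr => i _; rewrite !fctE /exp_sum scaler_suml scaler_sumr.
  apply: eq_bigr => j _; rewrite fctE !scalerA; congr (_ *: _).
  by rewrite exprMn rmorphM fmorphV rmorphXn rmorph_nat /=; ring.
have -> : cmean (fun z => expC (z * t%:C) *: resolvent T z) xi r n.+1 x - cs n =
    cmean (fun z => (expC (z * t%:C) - exp_sum J (z * t%:C)) *: resolvent T z) xi r n.+1 x.
  rewrite csE /cmean -opprD -scalerBr -sumrB; congr (- (_ *: _)).
  by apply: eq_bigr => i _; rewrite -scalerBr !fctE scalerBl.
apply: nm_cmean_le => // u hu; rewrite fctE nmZ.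
have [_ hb _] := hf _ hu.
by apply: ler_pM; rewrite ?nm_ge0 //; exact: exp_sum_unif.
Unshelve. all: by end_near. Qed.

Lemma null_powS m f : null_pow T xi m.+1 f ->
  dom T f /\ null_pow T xi m (op_shift T xi f).
Proof.
move=> [h1 h2]; split; first exact: (h1 0%N).
by split=> [j jm|]; rewrite -iterSr //; exact: h1.
Qed.

(** Apply R(z) to (T - xi) f = (T - z) f + (z - xi) f. Each use lowers the order of a generalized
    eigenvector by one. *)
Lemma resolvent_shift z f : ~ spectrum T z -> z != xi -> dom T f ->
  resolvent T z f = (z - xi)^-1 *: (resolvent T z (op_shift T xi f) - f).
Proof.
move=> hz zxi hf; have d0 : z - xi != 0 by rewrite subr_eq0.
rewrite -[LHS](scalerK d0); congr (_ *: _).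
have -> : op_shift T xi f = (T f - z *: f) + (z - xi) *: f.
  by rewrite scalerBl addrA subrK.
have RL := resolvent_linear hz.
rewrite (linD RL) (linZ RL) (resolvent_eq hz hf erefl).
by rewrite [RHS]addrC addKr.
Qed.

Lemma root_pt_neq0 N r k : 0 < r -> root_pt N r k != 0 :> C.
Proof.
move=> r0; apply/negP => /eqP h; have := nm_root_pt N r k.
by rewrite h nm0 => /eqP; rewrite eq_sym normr_eq0 gt_eqF.
Qed.

(** w^N = r^N gives w^(-l) = w^(N - l) / r^N, back to positive exponents. *)
Lemma sum_root_ptV N r l : 0 < r -> (0 < l < N)%N ->
  \sum_(k < N) (root_pt N r k : C) ^- l = 0.
Proof.
move=> r0 /andP[l0 lN].
have N0 : (0 < N)%N by apply: leq_ltn_trans lN.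
have E (k : 'I_N) : (root_pt N r k : C) ^- l = (r ^+ N)%:C^-1 * root_pt N r k ^+ (N - l).
  have h := @root_pt_neq0 N r k r0.
  have e : root_pt N r k ^+ N = root_pt N r k ^+ (N - l) * root_pt N r k ^+ l.
    by rewrite -exprD subnK // ltnW.
  rewrite -(root_ptX r k N0) e invfM mulrAC mulVf ?mul1r //.
  exact: expf_neq0.
rewrite (eq_bigr _ (fun k _ => E k)) -mulr_sumr sum_root_ptX ?mulr0 //.
by rewrite subn_gt0 lN -subn_gt0 subKn // ltnW.
Qed.

(** [resolvent_shift] trades (m, l) for (m - 1, l + 1), up to a multiple of the sum of the w^(-l),
    which is zero. The condition l + m <= N keeps every exponent met strictly between 0 and N. *)
Lemma resolvent_null_sum r N m l f : 0 < r -> ok r -> null_pow T xi m f ->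
  (0 < l)%N -> (l + m <= N)%N ->
  \sum_(k < N) (root_pt N r k * root_pt N r k ^- l) *:
    resolvent T (xi + root_pt N r k) f = 0.
Proof.
move=> r0 hr; elim: m f l => [|m IH] f l.
  move=> [_ /= ->] _ _; rewrite big1 // => k _.
  by rewrite lin0 ?scaler0 //; exact/resolvent_linear/hr/root_angle.
move=> /null_powS[hf hs] l0 lm.
rewrite (eq_bigr (fun k : 'I_N => (root_pt N r k * root_pt N r k ^- l.+1) *:
    resolvent T (xi + root_pt N r k) (op_shift T xi f) - root_pt N r k ^- l *: f)); last first.
  move=> k _; have h := @root_pt_neq0 N r k r0.
  rewrite [X in _ *: X = _]resolvent_shift //; [|exact/hr/root_angle|]; last first.
    by rewrite -subr_eq0 addrC addKr.
  rewrite addrC addKr scalerA scalerBr exprS (invfM (root_pt N r k) (_ ^+ l)); congr (_ *: _ - _ *: _).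
    by rewrite -[LHS]mulrA (mulrC (_ ^- l)).
  by rewrite mulrAC mulfV // mul1r.
rewrite sumrB (IH _ l.+1 hs isT) ?addSnnS // -scaler_suml sum_root_ptV ?scale0r ?subr0 //.
by rewrite l0 (leq_trans _ lm) // addnS ltnS leq_addr.
Qed.

(** Here l = 0, so one use of [resolvent_shift] leaves -f at each sample point and a sum killed by
    [resolvent_null_sum]. The mean equals f exactly as soon as N is large compared with m. *)
Lemma spectral_proj_null r m f : 0 < r -> ok r -> null_pow T xi m f -> Pi r f = f.
Proof.
move=> r0 hr; have [PL _ tr] := spectral_projP r0 hr; case: m => [|m].
  by move=> [_ /= ->]; rewrite lin0.
move=> /null_powS[hf hs]; apply: tends_unique (tr f) _.
apply: tends_near (tends_cst f); exists m.+1 => // n /= mn; symmetry.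
have n0 : (n.+1%:R : C) != 0 by rewrite pnatr_eq0.
have E (k : 'I_n.+1) : root_pt n.+1 r k *: resolvent T (xi + root_pt n.+1 r k) f =
    (root_pt n.+1 r k * root_pt n.+1 r k ^- 1) *:
      resolvent T (xi + root_pt n.+1 r k) (op_shift T xi f) - f.
  have h := @root_pt_neq0 n.+1 r k r0.
  rewrite [X in _ *: X = _]resolvent_shift //; [|exact/hr/root_angle|]; last first.
    by rewrite -subr_eq0 addrC addKr.
  by rewrite addrC addKr scalerA scalerBr expr1 mulfV // !scale1r.
rewrite /cmean (eq_bigr _ (fun k _ => E k)) sumrB (resolvent_null_sum r0 hr hs (isT : (0 < 1)%N)); last first.
  by rewrite add1n ltnS ltnW.
have fE : \sum_(k < n.+1) f = (n.+1%:R : C) *: f.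
  by rewrite sumr_const card_ord scaler_nat.
by rewrite sub0r scalerN opprK fE scalerA mulVf // scale1r.
Qed.

End SpectralProjector.

(** * Comparison of an operator with its restriction *)

Section FiniteDimension.
Context {R : realType}.
Local Notation C := R[i].

Lemma tends_cauchy_complex (c : nat -> C) :
  (forall e : R, 0 < e -> exists N, forall n, (N <= n)%N -> nm (c n - c N) < e) ->
  exists l, tends c l.
Proof.
move=> hc.
have real_cvg (u : nat -> R) :
    (forall n m, `|u n - u m| <= nm (c n - c m)) -> exists l : R, u @ \oo --> l.
  move=> hu; suff /cvg_ex[l hl] : cvg (u @ \oo) by exists l.
  apply/cauchy_cvgP/cauchy_exP => e /hc[N hN]; exists (u N), N => // n /= /hN h.
  by rewrite -ball_normE /= distrC; exact: le_lt_trans (hu _ _) h.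
have [|a ha] := real_cvg (fun n => complex.Re (c n)).
  move=> n m; have -> : complex.Re (c n) - complex.Re (c m) = complex.Re (c n - c m).
    by case: (c n) => p q; case: (c m).
  exact: nm_Re.
have [|b hb] := real_cvg (fun n => complex.Im (c n)).
  move=> n m; have -> : complex.Im (c n) - complex.Im (c m) = complex.Im (c n - c m).
    by case: (c n) => p q; case: (c m).
  exact: nm_Im.
by exists (a +i* b); exact: tends_ReIm.
Qed.

Lemma tends_eps (X : normedZmodType C) (u : nat -> X) l : tends u l ->
  forall e : R, 0 < e -> exists N, forall n, (N <= n)%N -> nm (u n - l) < e.
Proof.
move=> /cvgrPdist_lt ul e /ul[N _ hN]; exists N => n /hN.
by rewrite sub0r normrN ger0_norm ?nm_ge0.
Qed.

Lemma approx_tends (X : normedZmodType C) (A : X -> Prop) l :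
  (forall e : R, 0 < e -> exists2 x, A x & nm (x - l) < e) ->
  exists2 u : nat -> X, (forall n, A (u n)) & tends u l.
Proof.
move=> h.
have h' n : exists x, A x /\ nm (x - l) < n.+1%:R^-1.
  by have [|x hx xl] := h (n.+1%:R^-1); [rewrite invr_gt0 ltr0n|exists x].
have [u hu] := choice h'; exists u => [n|]; first by have [] := hu n.
apply: (@tends_le _ _ _ _ (fun n => n.+1%:R^-1)).
  by near=> n; have [_ /ltW] := hu n.
exact: cvg_harmonic.
Unshelve. all: by end_near. Qed.

(** Induction on d. If the first vector v is not in the span of the others, that span is closed by
    induction, so v has a distance D > 0 to it. Then |a| D <= |a v + y| for y in that span makes the
    v-coordinates of u Cauchy; subtracting their limit reduces the dimension. *)
Lemma span_closed (X : normedModType C) d (e : 'I_d -> X) u l :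
  (forall n, exists c : 'I_d -> C, u n = \sum_i c i *: e i) -> tends u l ->
  exists c : 'I_d -> C, l = \sum_i c i *: e i.
Proof.
elim: d e u l => [|d IH] e u l hu ul.
  exists (fun=> 0); rewrite big_ord0; apply: tends_unique ul _.
  apply: tends_near (tends_cst 0); near=> n.
  by have [c ->] := hu n; rewrite big_ord0.
pose e' i := e (lift ord0 i); pose v := e ord0.
have [[c0 vV]|vV] := pselect (exists c : 'I_d -> C, v = \sum_i c i *: e' i).
  have [|c ->] := IH e' u l _ ul.
    move=> n; have [c ->] := hu n; exists (fun i => c ord0 * c0 i + c (lift ord0 i)).
    rewrite big_ord_recl -/v vV scaler_sumr -big_split; apply: eq_bigr => i _ /=.
    by rewrite scalerA -scalerDl.
  exists (fun i => if unlift ord0 i is Some j then c j else 0).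
  rewrite big_ord_recl unlift_none scale0r add0r; apply: eq_bigr => i _.
  by rewrite liftK.
have [D D0 hD] : exists2 D : R, 0 < D & forall c : 'I_d -> C,
    D <= nm (\sum_i c i *: e' i - v).
  apply: contrapT => hn; apply: vV.
  have [|w hw wv] := @approx_tends _ (fun x => exists c : 'I_d -> C, x = \sum_i c i *: e' i) v.
    move=> eps eps0; apply: contrapT => hn'; apply: hn; exists eps => // c.
    rewrite leNgt; apply/negP => hlt; apply: hn'.
    by exists (\sum_i c i *: e' i) => //; exists c.
  exact: IH hw wv.
have hD' (a : C) (c : 'I_d -> C) : nm a * D <= nm (a *: v + \sum_i c i *: e' i).
  have [->|a0] := eqVneq a 0; first by rewrite nm0 mul0r nm_ge0.
  have -> : a *: v + \sum_i c i *: e' i = - a *: (\sum_i (- (a^-1 * c i)) *: e' i - v).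
    rewrite scalerBr !scaleNr opprK addrC; congr (_ + _).
    rewrite scaler_sumr -sumrN; apply: eq_bigr => i _.
    by rewrite scaleNr scalerN opprK scalerA mulVKf.
  by rewrite nmZ nmN ler_wpM2l ?nm_ge0.
have [c hc] := choice hu.
pose a n := c n ord0; pose y n := \sum_i c n (lift ord0 i) *: e' i.
have uE n : u n = a n *: v + y n by rewrite hc big_ord_recl.
have aC n m : nm (a n - a m) * D <= nm (u n - u m).
  apply: le_trans (hD' _ (fun i => c n (lift ord0 i) - c m (lift ord0 i))) _.
  rewrite !uE opprD addrACA -scalerBl /y -sumrB.
  by under [X in _ + X]eq_bigr do rewrite scalerBl.
have [|b hb] := @tends_cauchy_complex a.
  move=> eps eps0; have [|N hN] := tends_eps ul (e := eps * D / 2).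
    by rewrite divr_gt0 // mulr_gt0.
  exists N => n Nn; rewrite -(ltr_pM2r D0); apply: le_lt_trans (aC _ _) _.
  apply: le_lt_trans (nm_triangle l _ _) _; rewrite (nmBC l).
  have h1 := hN _ Nn; have h2 := hN _ (leqnn N).
  have -> : eps * D = eps * D / 2 + eps * D / 2 by field.
  exact: ltrD.
have yl : tends y (l - b *: v).
  have := tendsD ul (tendsN (tendsZ hb (tends_cst v))).
  by apply: tends_near; near=> n; rewrite uE addrAC subrr add0r.
have [|c' hc'] := IH e' y _ _ yl; first by move=> n; eexists; reflexivity.
exists (fun i => if unlift ord0 i is Some j then c' j else b).
rewrite big_ord_recl unlift_none -/v.
under eq_bigr do rewrite liftK.
by rewrite -[X in _ + X]hc' addrC subrK.
Unshelve. all: by end_near. Qed.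

End FiniteDimension.

Section Restriction.
Context {R : realType}.
Local Notation C := R[i].

Lemma dense_tends (X : normedModType C) (A : set X) x : dense A ->
  exists2 u : nat -> X, (forall n, A (u n)) & tends u x.
Proof.
move=> dA; apply: approx_tends => e e0.
have e0' : 0 < e%:C by rewrite ltcR.
have [||y [xy Ay]] := dA (ball x e%:C).
- by exists x; exact: ballxx.
- exact: ball_open.
exists y => //; move: xy; rewrite -ball_normE /= nmE ltcR nmBC //.
Qed.

Lemma continuous_linear_op_bound (X Y : normedModType C) (f : {linear X -> Y}) :
  continuous f -> exists2 c, 0 <= c & op_bound f c.
Proof.
move=> /linear_bounded_continuous/linear_boundedP hf.
near (@pinfty_nbhs C) => r.
have r0 : 0 < r by near: r; exact: nbhs_pinfty_gt.
have rE : r = (complex.Re r)%:C by rewrite RRe_real ?gtr0_real.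
exists (complex.Re r); first by rewrite -lecR -rE ltW.
move=> x; have : `|f x| <= r * `|x| by move: x; near: r.
by rewrite rE !nmE -rmorphM lecR.
Unshelve. all: by end_near. Qed.

(** A condition off the centre only, stable under shrinking r, so that L and LL can be brought to a
    common radius. *)
Definition punctured_regular (X : normedModType C) (T : unbounded_op X) xi (r : R) :=
  0 < r /\ forall z, z != xi -> nm (z - xi) <= r -> ~ spectrum T z.

Lemma contour_radius_punctured (X : normedModType C) (T : unbounded_op X) xi r :
  contour_radius T xi r -> punctured_regular T xi r.
Proof.
move=> [r0 [r' rr' [r'0 iso]]]; split=> // z zxi zr zT.
have : (spectrum T `&` [set z | `|z - xi| <= r'%:C]) z.
  by split => //=; rewrite nmE lecR; apply: le_trans zr (ltW rr').
by rewrite iso /= => /eqP; rewrite (negPf zxi).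
Qed.

Lemma punctured_circle (X : completeNormedModType C) (T : unbounded_op X) xi (r s : R) :
  punctured_regular T xi r -> 0 < s -> s <= r -> circle_ok T xi s.
Proof.
move=> [r0 hr] s0 sr t _; apply: hr.
  rewrite -subr_eq0 addrC addKr; apply/negP => /eqP h.
  have := nm_circle_point s t; rewrite h nm0 gtr0_norm // => h'.
  by rewrite -h' ltxx in s0.
by rewrite addrC addKr nm_circle_point gtr0_norm.
Qed.

Lemma punctured_proj_eq (X : completeNormedModType C) (T : unbounded_op X) xi (r s : R) x :
  punctured_regular T xi r -> 0 < s -> s <= r ->
  spectral_proj T xi r x = spectral_proj T xi s x.
Proof.
move=> hr s0 sr; apply: (spectral_proj_radius x s0 sr) => t /andP[st tr].
exact: punctured_circle hr (lt_le_trans s0 st) tr.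
Qed.

Variables (E EE : completeNormedModType C) (iota : {linear E -> EE}).
Hypothesis iota_inj : injective iota.
Hypothesis iota_cont : continuous iota.
Hypothesis iota_dense : dense (range iota).
Variables (LL : unbounded_op EE) (L : unbounded_op E).
Hypothesis L_restr : is_restriction iota LL L.

Lemma corestrK (T : EE -> EE) f : (exists g, iota g = T f) ->
  iota (corestr iota T f) = T f.
Proof. by move=> [g hg]; exact: (@xgetPex _ 0 [set g | iota g = T f] (ex_intro _ g hg)). Qed.

Lemma resolvent_restr z x : ~ spectrum L z -> ~ spectrum LL z ->
  resolvent LL z (iota x) = iota (resolvent L z x).
Proof.
move=> hL hLL; have [h1 h2] := L_restr (resolvent_dom hL x).
apply: resolvent_eq => //; rewrite h2 -linearZ -linearB.
by rewrite (resolventK hL x).2.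
Qed.

Lemma iota_tends (u : nat -> E) l : tends u l -> tends (fun n => iota (u n)) (iota l).
Proof.
have [c c0 hc] := continuous_linear_op_bound iota_cont.
by apply: tends_linear hc => x y; rewrite linearB.
Qed.

Let iotaL : linear iota := @linearP _ _ _ _ iota.
Let iotaZ (c : C) x : iota (c *: x) = c *: iota x := linZ iotaL c x.
Let iotaN x : iota (- x) = - iota x.
Proof. by rewrite -scaleN1r iotaZ scaleN1r. Qed.
Let iotaB x y : iota (x - y) = iota x - iota y := linB iotaL x y.
Let iota_sum (I : Type) (s : seq I) (F : I -> E) :
  iota (\sum_(i <- s) F i) = \sum_(i <- s) iota (F i).
Proof. exact: (lin_sum iotaL). Qed.

Section OneCircle.
Variables (xi : C) (r : R).
Hypotheses (r0 : 0 < r) (okL : circle_ok L xi r) (okLL : circle_ok LL xi r).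

Lemma cmean_restr phi N x :
  cmean (fun z => phi z *: resolvent LL z) xi r N (iota x) =
  iota (cmean (fun z => phi z *: resolvent L z) xi r N x).
Proof.
rewrite /cmean iotaN iotaZ iota_sum; congr (- (_ *: _)).
apply: eq_bigr => j _; rewrite !fctE resolvent_restr; last 2 first.
- exact/okL/root_angle.
- exact/okLL/root_angle.
by rewrite !iotaZ.
Qed.

Lemma spectral_proj_restr x :
  spectral_proj LL xi r (iota x) = iota (spectral_proj L xi r x).
Proof.
have [_ _ tLL] := spectral_projP r0 okLL; have [_ _ tL] := spectral_projP r0 okL.
apply: tends_unique (tLL _) _; apply: tends_near (iota_tends (tL x)); near=> n.
have := cmean_restr (fun=> 1) n.+1 x; rewrite /cmean.
by under eq_bigr do rewrite fctE scale1r; under [in RHS]eq_bigr do rewrite fctE scale1r.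
Unshelve. all: by end_near. Qed.

Lemma spectral_semigroup_restr t x :
  spectral_semigroup LL xi r t (iota x) = iota (spectral_semigroup L xi r t x).
Proof.
have [m [k [m0 k0 hmk]]] := @circle_scalar_exp R xi r t r0.
rewrite !spectral_semigroupE.
have [_ _ tLL] := resolvent_contour r0 okLL m0 k0 hmk.
have [_ _ tL] := resolvent_contour r0 okL m0 k0 hmk.
apply: tends_unique (tLL _) _; apply: tends_near (iota_tends (tL x)); near=> n.
by rewrite cmean_restr.
Unshelve. all: by end_near. Qed.

Hypothesis L_finite : finite_dimensional (range (spectral_proj L xi r)).

(* The range of the projector of L is finite dimensional, hence closed in the
   larger space, and by density it contains the range of the projector of LL. *)
Lemma spectral_proj_range f : exists g, iota g = spectral_proj LL xi r f.
Proof.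
have [d [e he]] := L_finite.
have [u hu uf] := dense_tends f iota_dense.
have [PL [c c0 Pc] _] := spectral_projP r0 okLL.
have tP : tends (fun n => spectral_proj LL xi r (u n)) (spectral_proj LL xi r f).
  by apply: tends_linear Pc uf => x y; exact: linB.
have [|k hk] := span_closed (e := iota \o e) _ tP.
  move=> n; have [h _ <-] := hu n; rewrite spectral_proj_restr.
  have [|k ->] := he (spectral_proj L xi r h); first by exists h.
  by exists k; rewrite linear_sum; apply: eq_bigr => i _; rewrite linearZ.
exists (\sum_i k i *: e i); rewrite hk linear_sum.
by apply: eq_bigr => i _; rewrite linearZ.
Qed.

(** For the inclusion into E: a generalized eigenvector of LL is fixed by the projector, hence lies
    in its range, which is contained in E; the induction handles its image under LL - xi. *)
Lemma null_pow_restr m : iota @` null_pow L xi m = null_pow LL xi m.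
Proof.
apply/seteqP; split.
  move=> _ [x [hx1 hx2] <-].
  have itE j : (j <= m)%N -> iter j (op_shift LL xi) (iota x) = iota (iter j (op_shift L xi) x).
    elim: j => // j IH jm /=; rewrite IH 1?ltnW // {1}/op_shift.
    have [_ ->] := L_restr (hx1 _ jm).
    by rewrite -linearZ -linearB.
  split; last by rewrite itE // hx2 linear0.
  by move=> j jm; rewrite itE 1?ltnW //; have [] := L_restr (hx1 _ jm).
elim: m => [|m IH] f.
  by move=> [_ /= ->]; exists 0; rewrite ?linear0 //; split.
move=> hf; have [hdom hs] := null_powS hf.
have [g gE] := spectral_proj_range f.
rewrite (spectral_proj_null r0 okLL hf) in gE.
have [g' hg' g'E] := IH _ hs.
have p0 : (0 : R) <= 0 <= 2 * (pi : R) by rewrite lexx mulr_ge0 // pi_ge0.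
pose z := xi + circle_point r 0.
have zL : ~ spectrum L z by exact: okL.
have zLL : ~ spectrum LL z by exact: okLL.
(* g lies in E but not yet in Dom(L). For any regular z on the circle, (LL - z) f = iota (g' - (z -
   xi) g), and since the resolvents agree on E, g is a value of R_L(z). *)
have gR : g = resolvent L z (g' - (z - xi) *: g).
  apply: iota_inj; rewrite -resolvent_restr // iotaB iotaZ gE g'E.
  symmetry; apply: resolvent_eq => //.
  by rewrite /op_shift scalerBl opprB addrA subrK.
have gdom : dom L g by rewrite gR; exact: resolvent_dom.
have gs : op_shift L xi g = g'.
  apply: iota_inj; rewrite g'E /op_shift iotaB iotaZ gE.
  by have [_ <-] := L_restr gdom; rewrite gE.
exists g => //; case: hg' => h1 h2; split.
  by case=> [|j] jm //; rewrite iterSr gs; exact: h1.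
by rewrite iterSr gs.
Qed.

Lemma spectral_proj_corestr f :
  let g := corestr iota (spectral_proj LL xi r) f in
  iota g = spectral_proj LL xi r f /\ spectral_proj L xi r g = g.
Proof.
have gE := corestrK (spectral_proj_range f); split; first exact: gE.
apply: iota_inj; rewrite -spectral_proj_restr gE.
exact: spectral_proj_idem.
Qed.

Hypotheses (LL_closed : closed_densely_defined LL) (L_closed : closed_densely_defined L).

(** S_LL(t) = exp(t LL) Pi_LL together with idempotence allows f to be replaced by Pi_LL f = iota g,
    and on E the two contour semigroups agree. *)
Lemma spectral_semigroup_corestr t f :
  let g := corestr iota (spectral_proj LL xi r) f in
  spectral_semigroup LL xi r t f = iota (spectral_semigroup L xi r t g) /\
  spectral_semigroup LL xi r t f = iota (exp_op L t g).
Proof.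
move=> g; have [gE gP] := spectral_proj_corestr f; rewrite -/g in gE gP.
have eL := spectral_semigroup_exp t g L_closed r0 okL; rewrite gP in eL.
suff h : spectral_semigroup LL xi r t f = iota (spectral_semigroup L xi r t g).
  by split; [exact: h|rewrite -eL; exact: h].
rewrite -spectral_semigroup_restr gE.
rewrite (spectral_semigroup_exp t f LL_closed r0 okLL).
rewrite (spectral_semigroup_exp t (spectral_proj LL xi r f) LL_closed r0 okLL).
by rewrite (spectral_proj_idem f r0 okLL).
Qed.

End OneCircle.
End Restriction.

(** * Factorization of the resolvent *)

Section Factorization.
Context {R : realType}.
Local Notation C := R[i].
Variables (E EE : completeNormedModType C) (iota : {linear E -> EE}).
Hypothesis iota_cont : continuous iota.
Variables (LL : unbounded_op EE) (L : unbounded_op E).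
Hypothesis L_restr : is_restriction iota LL L.
Variables (A : EE -> EE) (B : unbounded_op EE).
Hypothesis LL_dom : dom LL = dom B.
Hypothesis LL_split : forall f, dom LL f -> LL f = A f + B f.
Hypothesis A_linear : linear A.
Variables (a MA MB ME : R).
Hypotheses (MA0 : 0 <= MA) (MB0 : 0 <= MB) (ME0 : 0 <= ME).
Hypothesis A_bound : op_bound A MA.
Hypothesis B_regular : forall z, half_plane a z -> ~ spectrum B z.
Hypothesis B_bound : forall z, half_plane a z -> op_bound (resolvent B z) MB.
Variable n : nat.
Local Notation AR z := (A \o resolvent B z).
Hypothesis AR_range : forall z f, half_plane a z -> exists g, iota g = iter n (AR z) f.
Hypothesis AR_linear : forall z, half_plane a z -> linear (corestr iota (iter n (AR z))).
Hypothesis AR_bound : forall z, half_plane a z ->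
  op_bound (corestr iota (iter n (AR z))) ME.

Definition factor_sum z m (f : EE) : EE :=
  \sum_(0 <= l < m) (-1) ^+ l *: resolvent B z (iter l (AR z) f).

Definition factor_resolvent z (f : EE) : EE :=
  factor_sum z n f +
  (-1) ^+ n *: iota (resolvent L z (corestr iota (iter n (AR z)) f)).

Lemma op_shift_linear z x y c : dom LL x -> dom LL y ->
  op_shift LL z (c *: x + y) = c *: op_shift LL z x + op_shift LL z y.
Proof.
move=> hx hy; rewrite /op_shift op_linear // scalerBr scalerDr !scalerA (mulrC z).
by rewrite opprD addrACA.
Qed.

(** (LL - z) R_B(z) = 1 + A R_B(z), so the alternating sum telescopes. *)
Lemma factor_sumP z m f : half_plane a z -> dom LL (factor_sum z m f) /\
  op_shift LL z (factor_sum z m f) = f - (-1) ^+ m *: iter m (AR z) f.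
Proof.
move=> hz; have zB := B_regular hz; elim: m => [|m [IH1 IH2]].
  rewrite /factor_sum big_nil /op_shift op_lin0 scaler0 expr0 scale1r !subrr.
  by split=> //; exact: dom0.
have gd : dom LL (resolvent B z (iter m (AR z) f)).
  by rewrite LL_dom; exact: resolvent_dom.
rewrite /factor_sum big_nat_recr //= -/(factor_sum z m f) addrC; split.
  exact: dom_linear.
rewrite op_shift_linear // IH2 /op_shift LL_split // op_resolvent //.
set g := resolvent B z _.
rewrite (addrA (A g)) addrK scalerDr -addrA (addrC (_ *: iter m _ f)) subrK addrC.
by rewrite exprS mulN1r scaleNr opprK.
Qed.

Lemma factor_resolventP z f : half_plane a z -> ~ spectrum L z ->
  dom LL (factor_resolvent z f) /\ op_shift LL z (factor_resolvent z f) = f.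
Proof.
move=> hz zL; have [h1 h2] := factor_sumP n f hz.
set y := corestr iota (iter n (AR z)) f.
have yE : iota y = iter n (AR z) f by apply: corestrK; exact: AR_range.
have [d1 d2] := L_restr (resolvent_dom zL y).
have sE : op_shift LL z (iota (resolvent L z y)) = iota y.
  rewrite /op_shift d2 -(linZ (@linearP _ _ _ _ iota)) -(linB (@linearP _ _ _ _ iota)).
  by rewrite (resolventK zL y).2.
rewrite /factor_resolvent -/y addrC; split; first exact: dom_linear.
by rewrite op_shift_linear // h2 sE yE addrC subrK.
Qed.

Lemma factor_resolvent_eq z f : half_plane a z -> ~ spectrum L z -> ~ spectrum LL z ->
  resolvent LL z f = factor_resolvent z f.
Proof.
by move=> hz zL zLL; have [h1 h2] := factor_resolventP f hz zL; exact: resolvent_eq.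
Qed.

Lemma iter_AR_bound z l : half_plane a z -> op_bound (iter l (AR z)) ((MA * MB) ^+ l).
Proof.
move=> hz f; elim: l => [|l IH] /=; first by rewrite expr0 mul1r.
apply: le_trans (A_bound _) _; rewrite exprS -!mulrA ler_wpM2l //.
by apply: le_trans (B_bound hz _) _; rewrite ler_wpM2l.
Qed.

(** The constants k and k' do not depend on z: this is where the uniformity in z of the bounds on
    R_B(z) and (A R_B(z))^n enters. *)
Lemma factor_resolvent_bound : exists2 k : R, 0 <= k & exists2 k' : R, 0 <= k' &
  forall z c, half_plane a z -> 0 <= c -> op_bound (resolvent L z) c ->
  op_bound (factor_resolvent z) (k + k' * c).
Proof.
have [ci ci0 hi] := continuous_linear_op_bound iota_cont.
exists (\sum_(0 <= l < n) MB * (MA * MB) ^+ l).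
  by apply: sumr_ge0 => l _; rewrite mulr_ge0 // exprn_ge0 // mulr_ge0.
exists (ci * ME); first by rewrite mulr_ge0.
move=> z c hz c0 hc f; rewrite /factor_resolvent.
apply: le_trans (nmD _ _) _; rewrite mulrDl; apply: lerD.
  rewrite mulr_suml; apply: le_trans (nm_sum _ _ _) _; apply: ler_sum => l _.
  rewrite nmZ nmX nmN nm1 expr1n mul1r; apply: le_trans (B_bound hz _) _.
  by rewrite -mulrA ler_wpM2l //; exact: iter_AR_bound.
rewrite nmZ nmX nmN nm1 expr1n mul1r; apply: le_trans (hi _) _.
rewrite -!mulrA ler_wpM2l // mulrCA.
apply: le_trans (hc _) _; rewrite ler_wpM2l //; exact: AR_bound.
Qed.

Lemma nm_half_plane (z w : C) d : a + d <= complex.Re w -> nm (z - w) < d ->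
  half_plane a z.
Proof.
move=> hw zw; rewrite /half_plane /=.
have := nm_Re (z - w).
have -> : complex.Re (z - w) = complex.Re z - complex.Re w by case: (z) (w) => ? ? [].
move=> h; have := le_lt_trans h zw; rewrite ltr_norml => /andP[h1 _]; lra.
Qed.

(* The factored resolvent bounds the resolvent of LL locally uniformly off the
   spectrum of L, so regularity of LL propagates. *)
Lemma regular_locally_constant w : half_plane a w -> ~ spectrum L w ->
  exists2 d : R, 0 < d & forall z z', nm (z - w) < d -> nm (z' - w) < d ->
    ~ spectrum LL z -> ~ spectrum LL z'.
Proof.
move=> hw wL; have [c c0 hc] := resolvent_bounded wL.
have [k k0 [k' k'0 hk]] := factor_resolvent_bound.
pose K := k + k' * (2 * c).
have K0 : 0 <= K by rewrite addr_ge0 // !mulr_ge0.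
(* The first radius keeps z in the half-plane, the second bounds R_L(z) by 2 c, and the third gives
   |z' - z| K <= 1/2, so that [resolvent_open] leads from z to z'. *)
pose d := Num.min (complex.Re w - a) (Num.min (2 * (c + 1))^-1 (4 * (K + 1))^-1).
have c1 : 0 < 2 * (c + 1) by rewrite mulr_gt0 // ltr_wpDl.
have K1 : 0 < 4 * (K + 1) by rewrite mulr_gt0 // ltr_wpDl.
exists d; first by rewrite !lt_min subr_gt0 !invr_gt0 c1 K1 !andbT; exact: hw.
move=> z z'; rewrite !lt_min => /and3P[z1 z2 z3] /and3P[z1' z2' z3'] zLL.
have hz : half_plane a z by apply: nm_half_plane z1; rewrite addrC subrK.
have [zL zb] : ~ spectrum L z /\ op_bound (resolvent L z) (2 * c).
  apply: resolvent_open wL c0 hc _.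
  by move: z2; rewrite -div1r ltr_pdivlMr // => z2; have := nm_ge0 (z - w); nra.
have RK : op_bound (resolvent LL z) K.
  by move=> f; rewrite factor_resolvent_eq //; apply: hk => //; rewrite mulr_ge0.
apply: (resolvent_open zLL K0 RK _).1.
have h := nm_triangle w z' z; rewrite (nmBC w) in h.
move: z3 z3'; rewrite -div1r !ltr_pdivlMr // => z3 z3'.
by have := nm_ge0 (z - w); have := nm_ge0 (z' - w); have := nm_ge0 (z' - z); nra.
Qed.

(** LL - z = (1 + A R_B(z)) (B - z) with ||A R_B(z)|| <= 1/2. A Neumann series gives surjectivity,
    and absorbing A R_B(z) v into |v| gives the lower bound with constant 2 e. *)
Lemma regular_large z e : half_plane a z -> 0 <= e -> MA * e <= 1 / 2 ->
  op_bound (resolvent B z) e -> ~ spectrum LL z.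
Proof.
move=> hz e0 Ae Be; have zB := B_regular hz.
have RL := resolvent_linear zB.
have shift v : op_shift LL z (resolvent B z v) = AR z v + v.
  rewrite /op_shift LL_split; last by rewrite LL_dom; exact: resolvent_dom.
  by rewrite op_resolvent // addrA addrK.
have Kb : op_bound (AR z) (1 / 2).
  move=> v /=; apply: le_trans (A_bound _) _.
  apply: le_trans (ler_wpM2l MA0 (Be v)) _.
  by rewrite mulrA ler_wpM2r ?nm_ge0.
apply: (@spectrumN _ _ LL z (e * 2) _ _ _).1; first by rewrite mulr_ge0.
  move=> x.
  have NL : linear (fun v => - AR z v).
    by move=> c u v; rewrite /= RL A_linear opprD scalerN.
  have Nb : op_bound (fun v => - AR z v) (1 / 2) by move=> v; rewrite nmN; exact: Kb.
  have [||u hu] := neumann NL Nb _ _ x; [by lra|by lra|].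
  exists (resolvent B z u); first by rewrite LL_dom; exact: resolvent_dom.
  by rewrite -/(op_shift LL z _) shift {2}hu addrC subrK.
move=> y hy; have yB : dom B y by rewrite -LL_dom.
pose v := B y - z *: y.
have yE : resolvent B z v = y by exact: resolvent_eq.
have := shift v; rewrite yE /op_shift => ->.
rewrite -{1}yE; apply: le_trans (Be v) _; rewrite -mulrA ler_wpM2l //.
have h1 : nm v <= nm (AR z v + v) + nm (AR z v).
  by rewrite -{1}(addKr (AR z v) v) addrC (le_trans (nmB _ _)).
by have := Kb v; lra.
Qed.

Lemma half_plane_segment (z w : C) (t : R) : half_plane a z -> half_plane a w ->
  0 <= t <= 1 -> half_plane a (w + t%:C * (z - w)).
Proof.
rewrite /half_plane /=; case: z => x1 y1; case: w => x2 y2 /= h1 h2 /andP[t0 t1].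
by rewrite mul0r subr0; case: (leP x1 x2) => h; nra.
Qed.

(** The starting point w of the segment has two free coordinates: its abscissa is taken beyond rho,
    where [regular_large] applies, and its ordinate above finitely many forbidden values, so that
    the segment to z misses every xi j. *)
Lemma spectrum_off (k : nat) (xi : 'I_k -> C) (rho e : R) : 0 <= e -> MA * e <= 1 / 2 ->
  (forall z, half_plane a z -> rho < complex.Re z -> op_bound (resolvent B z) e) ->
  (forall z, half_plane a z -> ~ range xi z -> ~ spectrum L z) ->
  forall z, half_plane a z -> ~ range xi z -> ~ spectrum LL z.
Proof.
move=> e0 Ae Bl Lreg z hz zxi.
pose X := Num.max (complex.Re z) rho + 1.
have Xz : complex.Re z < X by rewrite ltr_pwDr // le_max lexx.
have Xr : rho < X by rewrite ltr_pwDr // le_max lexx orbT.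
(* The only ordinate for which the segment from z to X + i y can meet xi j. *)
pose bad j := complex.Im z + (complex.Im (xi j) - complex.Im z) *
  (X - complex.Re z) / (complex.Re (xi j) - complex.Re z).
pose y := 1 + \sum_j `|bad j|.
have ybad j : bad j < y.
  apply: le_lt_trans (ler_norm _) _; rewrite /y (bigD1 j) //= addrCA ltrDl.
  by rewrite ltr_pwDl // sumr_ge0.
pose w : C := X +i* y.
have hw : half_plane a w by rewrite /half_plane /=; apply: lt_trans Xz; exact: hz.
pose gam (t : R) := w + t%:C * (z - w).
(* At t = 1 the point is z, excluded by assumption. For t < 1, if the segment meets xi j, comparing
   slopes forces [bad j] = y, against [ybad]. *)
have gam_off t : 0 <= t <= 1 -> ~ range xi (gam t).
  move=> /andP[t0 t1] [j _ xj].
  have [te|tn] := eqVneq t 1.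
    by apply: zxi; exists j => //; rewrite xj /gam te mul1r addrC subrK.
  have t1' : t < 1 by rewrite lt_neqAle tn.
  have eR : complex.Re (xi j) - complex.Re z = (1 - t) * (X - complex.Re z).
    by rewrite xj /gam /w; case: (z) => p q /=; ring.
  have eI : complex.Im (xi j) - complex.Im z = (1 - t) * (y - complex.Im z).
    by rewrite xj /gam /w; case: (z) => p q /=; ring.
  have := ybad j; rewrite /bad eR eI.
  have -> : complex.Im z + (1 - t) * (y - complex.Im z) * (X - complex.Re z) /
      ((1 - t) * (X - complex.Re z)) = y.
    by field; rewrite !subr_eq0 !gt_eqF.
  by rewrite ltxx.
have -> : z = gam 1 by rewrite /gam mul1r addrC subrK.
apply: (@path_ind _ (fun t => ~ spectrum LL (gam t)) 0 1 ler01); last first.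
  rewrite /gam mul0r addr0; apply: regular_large hw e0 Ae (Bl _ hw _).
  by [].
move=> t ht; have hg := half_plane_segment hz hw ht.
have [d d0 hd] := regular_locally_constant hg (Lreg _ hg (gam_off _ ht)).
have n1 : 0 < nm (z - w) + 1 by rewrite ltr_wpDl // nm_ge0.
exists (d / (nm (z - w) + 1)); first by rewrite divr_gt0.
have gd s : `|s - t| < d / (nm (z - w) + 1) -> nm (gam s - gam t) < d.
  rewrite ltr_pdivlMr // => h; apply: le_lt_trans h.
  rewrite /gam opprD addrACA subrr add0r -mulrBl nmM -rmorphB nmR.
  by rewrite ler_wpM2l // lerDl.
by move=> s s' _ _ /gd hs /gd hs'; exact: hd.
Qed.

End Factorization.

(** * Independence of the contour radius, and assembly of the theorem *)

Section Radii.
Context {R : realType}.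
Local Notation C := R[i].
Variables (X : completeNormedModType C) (T : unbounded_op X) (xi : C).

Lemma punctured_le (r s : R) : punctured_regular T xi r -> 0 < s -> s <= r ->
  punctured_regular T xi s.
Proof.
move=> [r0 hr] s0 sr; split=> // z zxi zs; apply: hr => //; exact: le_trans sr.
Qed.

Lemma punctured_ok (r : R) : punctured_regular T xi r -> circle_ok T xi r.
Proof. by move=> hr; exact: (punctured_circle hr hr.1 (lexx r)). Qed.

Lemma spectral_proj_radius_eq (r s : R) :
  punctured_regular T xi r -> punctured_regular T xi s ->
  spectral_proj T xi r = spectral_proj T xi s.
Proof.
move=> hr hs; apply/funext => x; have [[r0 _] [s0 _]] := (hr, hs).
have [sr|/ltW rs] := leP s r; first exact: (punctured_proj_eq x hr s0 sr).
exact/esym/(punctured_proj_eq x hs r0 rs).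
Qed.

(** In S(t) = exp(t T) Pi only the projector refers to the radius. *)
Lemma spectral_semigroup_radius_eq (r s t : R) : closed_densely_defined T ->
  punctured_regular T xi r -> punctured_regular T xi s ->
  spectral_semigroup T xi r t = spectral_semigroup T xi s t.
Proof.
move=> cT hr hs; apply/funext => x; have [[r0 _] [s0 _]] := (hr, hs).
rewrite (spectral_semigroup_exp t x cT r0 (punctured_ok hr)).
rewrite (spectral_semigroup_exp t x cT s0 (punctured_ok hs)).
by rewrite (spectral_proj_radius_eq hr hs).
Qed.

End Radii.

Lemma finite_separation (R : realType) (k : nat) (xi : 'I_k -> R[i]) (z : R[i]) :
  exists2 d : R, 0 < d & forall j, xi j != z -> d < nm (xi j - z).
Proof.
suff [d d0 hd] : exists2 d : R, 0 < d & forall j, j \in enum 'I_k -> xi j != z ->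
    d < nm (xi j - z) by exists d => // j; apply: hd; rewrite mem_enum.
elim: (enum 'I_k) => [|i s [d d0 hd]]; first by exists 1.
have [e|ne] := eqVneq (xi i) z.
  exists d => // j; rewrite inE => /orP[/eqP -> |/hd //]; by rewrite e eqxx.
have p : 0 < nm (xi i - z).
  rewrite lt_neqAle nm_ge0 andbT eq_sym; apply: contra_neq ne => /nm_eq0/eqP.
  by rewrite subr_eq0 => /eqP.
exists (Num.min d (nm (xi i - z) / 2)); first by rewrite lt_min d0 divr_gt0.
move=> j; rewrite inE gt_min => /orP[/eqP -> _|/hd h /h -> //].
by apply/orP; right; lra.
Qed.

Theorem theorem1 (R : realType)
  (E EE : completeNormedModType R[i]) (iota : {linear E -> EE})
  (iota_inj : injective iota) (iota_cont : continuous iota)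
  (iota_dense : dense (range iota))
  (LL : unbounded_op EE) (L : unbounded_op E)
  (LL_closed : closed_densely_defined LL)
  (L_closed : closed_densely_defined L)
  (L_restr : is_restriction iota LL L)
  (a : R)
  (* H1 *)
  (k : nat) (xi : 'I_k -> R[i]) (xi_inj : injective xi)
  (L_spectrum : spectrum L `&` half_plane a = range xi)
  (L_discrete : range xi `<=` discrete_spectrum L)
  (* H2 *)
  (A : EE -> EE) (B : unbounded_op EE)
  (LL_dom : dom LL = dom B)
  (LL_split : forall f, dom LL f -> LL f = A f + B f)
  (B_closed : closed_densely_defined B)
  (B_bounded : exists M : R, forall z, half_plane a z ->
     ~ spectrum B z /\ (opnorm (resolvent B z) <= M%:E)%E)
  (B_vanish : forall eps : R, 0 < eps -> exists rho : R, forall z : R[i],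
     half_plane a z -> rho < complex.Re z ->
     (opnorm (resolvent B z) < eps%:E)%E)
  (A_bounded : bounded_op A)
  (n : nat) (n_ge1 : (1 <= n)%N)
  (AR_bounded : exists M : R, forall z, half_plane a z ->
     let ARn := iter n (A \o resolvent B z) in
     [/\ range ARn `<=` range iota, bounded_op (corestr iota ARn)
       & (opnorm (corestr iota ARn) <= M%:E)%E]) :
  [/\ (* (i) *)
      spectrum LL `&` half_plane a = range xi,
      (* (ii) *)
      forall z, half_plane a z -> ~ range xi z ->
        forall f : EE,
        resolvent LL z f =
          \sum_(0 <= l < n) (-1) ^+ l *:
             resolvent B z (iter l (A \o resolvent B z) f)
          + (-1) ^+ n *:
             iota (resolvent L z (corestr iota (iter n (A \o resolvent B z)) f))
    & (* (iii) *)
      forall i : 'I_k,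
      [/\ forall m, (1 <= m)%N ->
            iota @` null_pow L (xi i) m = null_pow LL (xi i) m,
          iota @` gen_eigenspace L (xi i) = gen_eigenspace LL (xi i)
        & forall r1 r2 : R,
          contour_radius LL (xi i) r1 -> contour_radius L (xi i) r2 ->
          let PiLL := spectral_proj LL (xi i) r1 in
          let PiL := spectral_proj L (xi i) r2 in
          [/\ forall f : E, PiLL (iota f) = iota (PiL f),
              range PiLL `<=` iota @` range PiL
            & forall t : R, 0 <= t -> forall f : EE,
              spectral_semigroup LL (xi i) r1 t f =
                iota (spectral_semigroup L (xi i) r2 t (corestr iota PiLL f)) /\
              spectral_semigroup LL (xi i) r1 t f =
                iota (exp_op L t (corestr iota PiLL f))]]].
Proof.
have /bounded_opP[AL [MA MA0 hMA]] := A_bounded.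
have [MB0 hMB0] := B_bounded; have [ME0 hME0] := AR_bounded.
have Breg z : half_plane a z -> ~ spectrum B z by move=> /hMB0[].
(* The hypothesis gives no sign for its bound; the maximum with 0 supplies a nonnegative
   constant. *)
have hMB z : half_plane a z -> op_bound (resolvent B z) (Num.max 0 MB0).
  move=> hz; have [zB h] := hMB0 _ hz; apply: opnorm_op_bound.
    exact: resolvent_linear.
  by apply: le_trans h _; rewrite lee_fin le_max lexx orbT.
have hrange z f : half_plane a z -> exists g, iota g = iter n (A \o resolvent B z) f.
  by move=> /hME0[h _ _]; have [g _ gE] := h _ (ex_intro2 _ _ f I erefl); exists g.
have hlin z : half_plane a z -> linear (corestr iota (iter n (A \o resolvent B z))).
  by move=> /hME0[_ [h _] _].
have hME z : half_plane a z ->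
    op_bound (corestr iota (iter n (A \o resolvent B z))) (Num.max 0 ME0).
  move=> hz; have [_ _ h] := hME0 _ hz; apply: opnorm_op_bound; first exact: hlin.
  by apply: le_trans h _; rewrite lee_fin le_max lexx orbT.
have MBp : 0 <= Num.max 0 MB0 by rewrite le_max lexx.
have MEp : 0 <= Num.max 0 ME0 by rewrite le_max lexx.
have Lreg z : half_plane a z -> ~ range xi z -> ~ spectrum L z.
  by move=> hz zxi zL; apply: zxi; rewrite -L_spectrum; split.
have xi_half i : half_plane a (xi i).
  have : range xi (xi i) by exists i.
  by rewrite -L_spectrum => -[].
(* Chosen so that [MA * e] <= 1/2, as [regular_large] requires. *)
pose e := (2 * (MA + 1))^-1.
have MA1 : 0 < 2 * (MA + 1) by rewrite mulr_gt0 // ltr_wpDl.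
have e0 : 0 < e by rewrite invr_gt0.
have Ae : MA * e <= 1 / 2 by rewrite ler_pdivrMr //; lra.
have [rho hrho] := B_vanish _ e0.
have hlarge z : half_plane a z -> rho < complex.Re z -> op_bound (resolvent B z) e.
  move=> hz zr; apply: opnorm_op_bound; first exact/resolvent_linear/Breg.
  exact/ltW/hrho.
have LLreg : forall z, half_plane a z -> ~ range xi z -> ~ spectrum LL z.
  exact: (spectrum_off iota_cont L_restr LL_dom LL_split AL MA0 MBp MEp hMA
    Breg hMB hrange hME (ltW e0) Ae hlarge Lreg).
(* A discrete eigenvalue has an eigenvector x of L, and iota x is a nonzero eigenvector of LL
   because iota is injective. *)
have xi_spec i : spectrum LL (xi i).
  apply: contrapT => h.
  have [|[x xdom [x0 xE]] _] := L_discrete (xi i); first by exists i.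
  have [d1 d2] := L_restr _ xdom.
  suff : iota x = iota 0 by move=> /iota_inj x00; rewrite x00 eqxx in x0.
  rewrite linear0; apply: (op_shift_inj h) => //; first exact: dom0.
  rewrite d2 xE (linZ (@linearP _ _ _ _ iota)) op_lin0 scaler0.
  by rewrite !subrr.
split.
- apply/seteqP; split=> [z [zLL hz]|_ [i _ <-]]; last by split.
  by apply: contrapT => zxi; exact: (LLreg _ hz zxi).
- move=> z hz zxi f.
  exact: (factor_resolvent_eq L_restr LL_dom LL_split Breg hrange f hz
    (Lreg _ hz zxi) (LLreg _ hz zxi)).
move=> i.
have [_ [r' /contour_radius_punctured hr' fin']] : discrete_spectrum L (xi i).
  by apply: L_discrete; exists i.
have [d d0 hd] := finite_separation xi (xi i).
(* The closed disc of radius q around xi i stays in the half-plane and contains no other xi j. *)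
pose q := Num.min d ((complex.Re (xi i) - a) / 2).
have xia : 0 < (complex.Re (xi i) - a) / 2.
  by rewrite divr_gt0 // subr_gt0; exact: xi_half.
have hq : punctured_regular LL (xi i) q.
  split=> [|z zxi]; first by rewrite lt_min d0.
  rewrite le_min => /andP[z1 z2]; apply: LLreg.
    by apply: (@nm_half_plane _ a z (xi i) (complex.Re (xi i) - a)); lra.
  move=> [j _ jz]; have := hd j; rewrite jz => /(_ zxi).
  by rewrite ltNge z1.
(* Finite dimension is known only for the radius r' of [discrete_spectrum]; independence of the
   radius moves it to s. *)
have main s : punctured_regular L (xi i) s -> punctured_regular LL (xi i) s ->
    [/\ 0 < s, circle_ok L (xi i) s, circle_ok LL (xi i) s &
      finite_dimensional (range (spectral_proj L (xi i) s))].
  move=> hL hLL; split; [by case: hL|exact: punctured_ok|exact: punctured_ok|].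
  by rewrite (spectral_proj_radius_eq hL hr').
have null_eq m : iota @` null_pow L (xi i) m = null_pow LL (xi i) m.
  have s0 : 0 < Num.min r' q by rewrite lt_min hr'.1 hq.1.
  have [||_ oL oLL fin] := main (Num.min r' q).
  - by apply: (punctured_le hr' s0); rewrite ge_min lexx.
  - by apply: (punctured_le hq s0); rewrite ge_min lexx orbT.
  exact: (null_pow_restr iota_inj iota_cont iota_dense L_restr s0 oL oLL fin).
split; first by move=> m _; exact: null_eq.
  rewrite /gen_eigenspace image_bigcup; apply: eq_bigcupr => m _; exact: null_eq.
move=> r1 r2 /contour_radius_punctured h1 /contour_radius_punctured h2 PiLL PiL.
have s0 : 0 < Num.min r1 r2 by rewrite lt_min h1.1 h2.1.
(* The two projectors come with unrelated radii; both are moved to the smaller one, where the circle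
   is regular for L and for LL at once. *)
set s := Num.min r1 r2 in s0.
have hsLL : punctured_regular LL (xi i) s.
  by apply: (punctured_le h1 s0); rewrite ge_min lexx.
have hsL : punctured_regular L (xi i) s.
  by apply: (punctured_le h2 s0); rewrite ge_min lexx orbT.
have [_ oL oLL fin] := main s hsL hsLL.
rewrite /PiLL /PiL (spectral_proj_radius_eq h1 hsLL) (spectral_proj_radius_eq h2 hsL).
split.
- exact: (spectral_proj_restr iota_cont L_restr s0 oL oLL).
- move=> _ [f _ <-].
  have [gE gP] := spectral_proj_corestr iota_inj iota_cont iota_dense L_restr s0 oL oLL fin f.
  exists (corestr iota (spectral_proj LL (xi i) s) f); last exact: gE.
  by exists (corestr iota (spectral_proj LL (xi i) s) f).
move=> t _ f.
rewrite (spectral_semigroup_radius_eq t LL_closed h1 hsLL).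
rewrite (spectral_semigroup_radius_eq t L_closed h2 hsL).
exact: (spectral_semigroup_corestr iota_inj iota_cont iota_dense L_restr s0 oL oLL fin
  LL_closed L_closed t f).
Qed.
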